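(* If $A$ is a finitely $\boldsymbol{\sigma}$-presented étale difference algebra over a difference field $k$, then its strong core $\pi_0^\sigma(A)$ is a strongly $\boldsymbol{\sigma}$-étale $k$-algebra.
   Context: A difference ring is a commutative unital ring with an endomorphism $\sigma$; a difference field is a difference ring that is a field; $\lfloor R\rfloor$ is the underlying ring. A (difference) $k$-algebra is a difference ring $A$ with a difference ring morphism $k\to A$. A cocorrespondence $A_0\xrightarrow{p}C_0\xleftarrow{s}A_0$ of $\lfloor k\rfloor$-algebras consists of a $\lfloor k\rfloor$-algebra homomorphism $p$ and a ring homomorphism $s$ with $s(\lambda a)=\sigma_k(\lambda)s(a)$ for $\lambda\in k$. Its directly presented $k$-algebra $\lceil A_0;C_0|^k$ is the $k$-algebra representing the functor $B\mapsto\{c\in\lfloor k\rfloor\text{-}\mathbf{Alg}(C_0,\lfloor B\rfloor):\sigma_B\circ c\circ p=c\circ s\}$ on $k$-algebras. A $k$-algebra $A$ is finitely $\boldsymbol{\sigma}$-presented étale if $A\simeq\lceil A_0;C_0|^k$ for some cocorrespondence of (finite-dimensional) étale $\lfloor k\rfloor$-algebras. A $k$-algebra $A$ is $\boldsymbol{\sigma}$-separable if the $k$-homomorphism $A\otimes_kk\to A$, $a\otimes\lambda\mapsto\sigma_A(a)\lambda$, is injective, where the tensor product is the base change of $A$ along $\sigma_k:k\to k$. It is strongly $\boldsymbol{\sigma}$-étale if it is $\boldsymbol{\sigma}$-separable and $\lfloor A\rfloor$ is an étale (in particular finite-dimensional) $\lfloor k\rfloor$-algebra. The strong core $\pi_0^\sigma(A)$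 is the union of all strongly $\boldsymbol{\sigma}$-étale $k$-subalgebras of $A$. *)

(* Defs.v *)
From HB Require Import structures.
From mathcomp Require Import all_boot all_order all_algebra all_field.
From mathcomp Require Import boolp.

Set Implicit Arguments.
Unset Strict Implicit.
Unset Printing Implicit Defensive.

Import GRing.Theory.
Local Open Scope ring_scope.
Local Open Scope quotient_scope.

(* Rings are commutative and unital but may be zero (comPzRingType): the
   algebra presented by a cocorrespondence can be the zero ring. *)

Record kalg (k : fieldType) := KAlg {
  kalg_ring :> comPzRingType;
  kalg_str : {rmorphism k -> kalg_ring} }.

Definition is_kalg_hom (k : fieldType) (A B : kalg k)
    (f : {rmorphism A -> B}) : Prop :=
  forall x : k, f (kalg_str A x) = kalg_str B x.

Record diffField := DiffField {
  diffField_field :> fieldType;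
  sigma_field : {rmorphism diffField_field -> diffField_field} }.

Record diffAlg (k : diffField) := DiffAlg {
  diffAlg_kalg :> kalg k;
  sigma : {rmorphism diffAlg_kalg -> diffAlg_kalg};
  sigma_str : forall x : k,
    sigma (kalg_str diffAlg_kalg x)
    = kalg_str diffAlg_kalg (sigma_field k x) }.

Definition is_diffAlg_hom (k : diffField) (A B : diffAlg k)
    (f : {rmorphism A -> B}) : Prop :=
  is_kalg_hom f /\ forall a : A, f (sigma A a) = sigma B (f a).

(* A is k-isomorphic, via a |-> (pr i a)_i, to a finite (possibly empty)
   product of finite separable field extensions of k. *)
Definition etale (k : fieldType) (A : kalg k) : Prop :=
  exists (n : nat) (L : 'I_n -> fieldExtType k)
         (pr : forall i, {rmorphism A -> L i}),
    [/\ forall i, separable 1%VS {:L i},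
        forall i (x : k), pr i (kalg_str A x) = x%:A &
        forall y : (forall i, L i), exists! a : A, forall i, pr i a = y i].

Record cocorrespondence (k : diffField) := Cocorrespondence {
  coc_A0 : kalg k;
  coc_C0 : kalg k;
  coc_p : {rmorphism coc_A0 -> coc_C0};
  coc_s : {rmorphism coc_A0 -> coc_C0};
  coc_p_hom : is_kalg_hom coc_p;
  coc_s_semilinear : forall (l : k) (a : coc_A0),
    coc_s (kalg_str coc_A0 l * a)
    = kalg_str coc_C0 (sigma_field k l) * coc_s a }.

(* c is an element of the value at B of the functor that the directly
   presented algebra represents. *)
Definition directed_point (k : diffField) (X : cocorrespondence k)
    (B : diffAlg k) (c : {rmorphism coc_C0 X -> B}) : Prop :=
  is_kalg_hom c /\
  forall a : coc_A0 X, sigma B (c (coc_p X a)) = c (coc_s X a).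

(* A represents the functor directed_point X, u being its universal element:
   composition with u is a bijection from k-Alg(A, B) onto the points of B. *)
Definition directly_presented (k : diffField) (X : cocorrespondence k)
    (A : diffAlg k) : Prop :=
  exists u : {rmorphism coc_C0 X -> A},
    directed_point u /\
    forall (B : diffAlg k) (c : {rmorphism coc_C0 X -> B}),
      directed_point c ->
      exists f : {rmorphism A -> B},
        [/\ is_diffAlg_hom f, f \o u =1 c &
            forall g : {rmorphism A -> B},
              is_diffAlg_hom g -> g \o u =1 c -> g =1 f].

Definition finitely_sigma_presented_etale (k : diffField) (A : diffAlg k)
    : Prop :=
  exists X : cocorrespondence k,
    [/\ etale (coc_A0 X), etale (coc_C0 X) & directly_presented X A].

(* The tensor product A (x)_k k over sigma_k : k -> k, as the quotient of the
   formal sums of pairs (a, l) by the congruence that makes (a, l) |-> a (x) l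
   biadditive and balanced. *)
Section BaseChange.

Variables (k : diffField) (A : kalg k).

Inductive tensor_eq : seq (A * k) -> seq (A * k) -> Prop :=
  | tensor_refl s : tensor_eq s s
  | tensor_sym s t : tensor_eq s t -> tensor_eq t s
  | tensor_trans t s u : tensor_eq s t -> tensor_eq t u -> tensor_eq s u
  | tensor_cat s s' t t' :
      tensor_eq s s' -> tensor_eq t t' -> tensor_eq (s ++ t) (s' ++ t')
  | tensor_catC s t : tensor_eq (s ++ t) (t ++ s)
  | tensor_0l l : tensor_eq [:: (0, l)] [::]
  | tensor_Dl a b l : tensor_eq [:: (a + b, l)] [:: (a, l); (b, l)]
  | tensor_Dr a l m : tensor_eq [:: (a, l + m)] [:: (a, l); (a, m)]
  | tensor_balanced x a l :
      tensor_eq [:: (kalg_str A x * a, l)] [:: (a, sigma_field k x * l)].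

Definition tensor_eqb (s t : seq (A * k)) : bool := `[< tensor_eq s t >].

Lemma tensor_eqb_refl : reflexive tensor_eqb.
Proof. by move=> s; apply/asboolP; exact: tensor_refl. Qed.

Lemma tensor_eqb_sym : symmetric tensor_eqb.
Proof.
by move=> s t; apply/asboolP/asboolP => /tensor_sym.
Qed.

Lemma tensor_eqb_trans : transitive tensor_eqb.
Proof.
move=> t s u /asboolP st /asboolP tu; apply/asboolP; exact: tensor_trans tu.
Qed.

Canonical tensor_equiv :=
  EquivRel tensor_eqb tensor_eqb_refl tensor_eqb_sym tensor_eqb_trans.

Definition base_change := {eq_quot tensor_equiv}.

HB.instance Definition _ := Choice.on base_change.
HB.instance Definition _ := Quotient.on base_change.
HB.instance Definition _ := EqQuotient.on base_change.

Definition tensor_sum (s : seq (A * k)) : base_change := \pi_base_change s.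

Definition tensor (a : A) (l : k) : base_change := tensor_sum [:: (a, l)].

Lemma tensor_sumP s t : tensor_sum s = tensor_sum t <-> tensor_eq s t.
Proof.
split; first by move/eqmodP/asboolP.
by move=> st; apply/eqmodP/asboolP.
Qed.

Lemma tensor_sumK (x : base_change) : tensor_sum (repr x) = x.
Proof. exact: reprK. Qed.

Definition tensor_add (x y : base_change) := tensor_sum (repr x ++ repr y).

Definition tensor_opp (x : base_change) :=
  tensor_sum [seq (- al.1, al.2) | al <- repr x].

Lemma tensor_addE s t :
  tensor_add (tensor_sum s) (tensor_sum t) = tensor_sum (s ++ t).
Proof.
by apply/tensor_sumP/tensor_cat; apply/tensor_sumP; rewrite tensor_sumK.
Qed.

Lemma tensor_addA : associative tensor_add.
Proof.
move=> x y z; rewrite -(tensor_sumK x) -(tensor_sumK y) -(tensor_sumK z).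
by rewrite !tensor_addE catA.
Qed.

Lemma tensor_addC : commutative tensor_add.
Proof.
by move=> x y; apply/tensor_sumP; exact: tensor_catC.
Qed.

Lemma tensor_add0 : left_id (tensor_sum [::]) tensor_add.
Proof. by move=> x; rewrite -{1}(tensor_sumK x) tensor_addE tensor_sumK. Qed.

Lemma tensor_cancel s :
  tensor_eq ([seq (- al.1, al.2) | al <- s] ++ s) [::].
Proof.
elim: s => [|[a l] s IHs]; first exact: tensor_refl.
have al0 : tensor_eq [:: (- a, l); (a, l)] [::].
  by apply: tensor_trans (tensor_0l l); apply: tensor_sym;
     rewrite -{1}(addNr a); exact: tensor_Dl.
rewrite /= -cat1s -(cat1s (a, l)).
rewrite -[X in tensor_eq _ X]/([::] ++ [::]).
apply: tensor_trans (tensor_cat al0 IHs).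
rewrite -(cat1s (- a, l) [:: _]) -catA; apply: tensor_cat (tensor_refl _) _.
rewrite !catA; apply: tensor_cat (tensor_refl _); exact: tensor_catC.
Qed.

Lemma tensor_addN : left_inverse (tensor_sum [::]) tensor_opp tensor_add.
Proof.
move=> x; rewrite -{2}(tensor_sumK x) /tensor_opp tensor_addE.
by apply/tensor_sumP; exact: tensor_cancel.
Qed.

HB.instance Definition _ := GRing.isZmodule.Build base_change
  tensor_addA tensor_addC tensor_add0 tensor_addN.

Lemma tensor_sumE s : tensor_sum s = \sum_(al <- s) tensor al.1 al.2.
Proof.
elim: s => [|[a l] s IHs]; first by rewrite big_nil.
by rewrite big_cons -IHs -[RHS]/(tensor_add _ _) tensor_addE.
Qed.

End BaseChange.

Section SigmaSeparable.

Variables (k : diffField) (A : diffAlg k).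

Definition sigma_mul_sum (s : seq (A * k)) : A :=
  \sum_(al <- s) sigma A al.1 * kalg_str A al.2.

Lemma sigma_mul_sum_eq s t : tensor_eq s t -> sigma_mul_sum s = sigma_mul_sum t.
Proof.
rewrite /sigma_mul_sum; elim => //=.
- by move=> {}t {}s u _ -> _ ->.
- by move=> {}s s' {}t t' _ + _; rewrite !big_cat /= => -> ->.
- by move=> {}s {}t; rewrite !big_cat /= addrC.
- by move=> l; rewrite big_seq1 big_nil /= rmorph0 mul0r.
- by move=> a b l; rewrite !big_cons !big_nil /= !addr0 rmorphD mulrDl.
- by move=> a l m; rewrite !big_cons !big_nil /= !addr0 rmorphD mulrDr.
- move=> x a l; rewrite !big_seq1 /= !rmorphM /= sigma_str.
  by rewrite mulrAC mulrC mulrA.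
Qed.

(* The k-homomorphism A (x)_k k -> A, a (x) l |-> sigma_A(a) l. *)
Definition sigma_mul (x : base_change A) : A := sigma_mul_sum (repr x).

Lemma sigma_mul_tensor_sum s : sigma_mul (tensor_sum s) = sigma_mul_sum s.
Proof.
by apply: sigma_mul_sum_eq; apply/tensor_sumP; rewrite tensor_sumK.
Qed.

Lemma sigma_mul_tensor a l : sigma_mul (tensor a l) = sigma A a * kalg_str A l.
Proof. by rewrite sigma_mul_tensor_sum /sigma_mul_sum big_seq1. Qed.

Lemma sigma_mulD : {morph sigma_mul : x y / x + y}.
Proof.
move=> x y; rewrite -[x + y]/(tensor_add x y) sigma_mul_tensor_sum.
exact: big_cat.
Qed.

Definition sigma_separable : Prop := injective sigma_mul.

Definition strongly_sigma_etale : Prop := sigma_separable /\ etale A.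

End SigmaSeparable.

Record diffSubalg (k : diffField) (A : diffAlg k) := DiffSubalg {
  diffSubalg_pred :> subringClosed A;
  diffSubalg_str : forall x : k, kalg_str A x \in diffSubalg_pred;
  diffSubalg_sigma : forall a : A,
    a \in diffSubalg_pred -> sigma A a \in diffSubalg_pred }.

Section SubalgStructure.

Variables (k : diffField) (A : diffAlg k) (S : diffSubalg A).

Record diffSubalg_sort := DiffSubalgElt {
  diffSubalg_val : A;
  diffSubalg_valP : diffSubalg_val \in diffSubalg_pred S }.

HB.instance Definition _ := [isSub for diffSubalg_val].
HB.instance Definition _ := [Choice of diffSubalg_sort by <:].
HB.instance Definition _ :=
  GRing.SubChoice_isSubComPzRing.Build A _ diffSubalg_sort
    (GRing.subringClosedP _).

Definition subalg_str (x : k) : diffSubalg_sort :=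
  DiffSubalgElt (diffSubalg_str S x).

Definition subalg_sigma (a : diffSubalg_sort) : diffSubalg_sort :=
  DiffSubalgElt (diffSubalg_sigma (diffSubalg_valP a)).

Lemma subalg_str_zmod : zmod_morphism subalg_str.
Proof. by move=> x y; apply: val_inj; rewrite /= rmorphB. Qed.

Lemma subalg_str_monoid : monoid_morphism subalg_str.
Proof.
by split=> [|x y]; apply: val_inj; rewrite /= ?rmorph1 ?rmorphM.
Qed.

HB.instance Definition _ :=
  GRing.isZmodMorphism.Build k diffSubalg_sort subalg_str subalg_str_zmod.
HB.instance Definition _ :=
  GRing.isMonoidMorphism.Build k diffSubalg_sort subalg_str subalg_str_monoid.

Lemma subalg_sigma_zmod : zmod_morphism subalg_sigma.
Proof. by move=> x y; apply: val_inj; rewrite /= rmorphB. Qed.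

Lemma subalg_sigma_monoid : monoid_morphism subalg_sigma.
Proof.
by split=> [|x y]; apply: val_inj; rewrite /= ?rmorph1 ?rmorphM.
Qed.

HB.instance Definition _ :=
  GRing.isZmodMorphism.Build diffSubalg_sort diffSubalg_sort subalg_sigma
    subalg_sigma_zmod.
HB.instance Definition _ :=
  GRing.isMonoidMorphism.Build diffSubalg_sort diffSubalg_sort subalg_sigma
    subalg_sigma_monoid.

Lemma subalg_sigma_str (x : k) :
  subalg_sigma (subalg_str x) = subalg_str (sigma_field k x).
Proof. by apply: val_inj; rewrite /= sigma_str. Qed.

Definition subalg_diffAlg : diffAlg k :=
  @DiffAlg k (@KAlg k diffSubalg_sort subalg_str) subalg_sigma
    subalg_sigma_str.

End SubalgStructure.

Definition strong_core (k : diffField) (A : diffAlg k) (a : A) : Prop :=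
  exists S : diffSubalg A,
    strongly_sigma_etale (subalg_diffAlg S) /\ a \in diffSubalg_pred S.

(* Main.v *)
From HB Require Import structures.
Require Import Defs.
From mathcomp Require Import all_boot all_order all_algebra all_field.
From mathcomp Require Import boolp classical_sets functions.

Set Implicit Arguments.
Unset Strict Implicit.
Unset Printing Implicit Defensive.

Import GRing.Theory.
Local Open Scope ring_scope.
Local Open Scope quotient_scope.

(** Let [X] be the cocorrespondence presenting [A], [p, s : A0 -> C0] its maps and
    [u : C0 -> A] the universal element. A point of [A] in an algebra [B] is an
    infinite path: semilinear maps [c_0, c_1, ...] from [C0] to [B], the edges,
    where [c_(i+1) o p = c_i o s] is the vertex shared by consecutive edges.
    Two paths with the same [n]-th vertex can be spliced there ([splice]). So an
    element of [A] that depends only on the edges before the [n]-th vertex, and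
    also only on the edges after it, depends only on that vertex: it lies in the
    [k]-span of [sigma^n (u (p A0))] ([head_tail]), whose dimension is at most
    that of [A0].

    For a finite-dimensional algebra, injectivity of [a (x) l |-> sigma a * l] is
    equivalent to its surjectivity, that is, to the algebra being spanned by its
    image under [sigma], hence also by its image under each [sigma^n]
    ([sigma_separableP], [sigma_span_all]). A strongly sigma-etale subalgebra is
    contained, by finite dimension, in the subalgebra generated by the first [n]
    edges for some [n]; being spanned by the image of [sigma^n], it satisfies both
    conditions above. This bounds its dimension by that of [A0], uniformly
    ([strongly_sigma_etale_bound]).

    Surjectivity, unlike injectivity, is inherited by the compositum of two
    subalgebras, and so is being etale ([strongly_sigma_etale_join]). Therefore a
    strongly sigma-etale subalgebra of largest dimension absorbs all the others
    and is the strong core.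

    Two tools make this elementary. Etale algebras are characterised as the
    finite-dimensional algebras with a separability idempotent ([etaleP]), a
    condition that visibly passes to quotients and composita; averaging against
    that idempotent also makes linear retractions equivariant
    ([equivariant_retraction]). In [head_tail], such a retraction [q] of [A] onto
    the functions of the vertex gives an equivariant map [phi a = a - q a] killing
    exactly them; the two paths to be spliced then live in the ring of operators
    [x |-> \sum_i a_i * phi (p_i * x)], where comparing them at [x = 1] yields
    [phi f = 0]. *)

(** * Linear algebra over a field inside a commutative algebra *)

Section LinearAlgebra.

Variables (k : fieldType) (A : kalg k).
Implicit Types (x y : k) (a b : A) (U W : A -> Prop).

Definition subspace U : Prop :=
  U 0 /\ forall x a b, U a -> U b -> U (kalg_str A x * a + b).

Lemma subspaceD U a b : subspace U -> U a -> U b -> U (a + b).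
Proof. by move=> [_ hU] Ua; rewrite -[a]mul1r -(rmorph1 (kalg_str A)); apply: hU. Qed.

Lemma subspaceZ U x a : subspace U -> U a -> U (kalg_str A x * a).
Proof. by move=> [U0 hU] Ua; rewrite -[_ * _]addr0; apply: hU. Qed.

Lemma subspaceN U a : subspace U -> U a -> U (- a).
Proof.
by move=> hU Ua; rewrite -mulN1r -(rmorphN1 (kalg_str A)); apply: subspaceZ.
Qed.

Lemma subspace_sum U (I : Type) (r : seq I) (P : pred I) (F : I -> A) :
  subspace U -> (forall i, P i -> U (F i)) -> U (\sum_(i <- r | P i) F i).
Proof.
move=> hU UF; apply: (big_ind U) => [|a b|//]; first by case: hU.
exact: subspaceD.
Qed.

Definition comb (I : finType) (v : I -> A) (c : I -> k) : A :=
  \sum_i kalg_str A (c i) * v i.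

Definition spanned (I : finType) (v : I -> A) : A -> Prop :=
  fun a => exists c, a = comb v c.

Definition free_family (I : finType) (v : I -> A) : Prop :=
  forall c, comb v c = 0 -> forall i, c i = 0.

Lemma combP (I : finType) (v : I -> A) x c d :
  comb v (fun i => x * c i + d i) = kalg_str A x * comb v c + comb v d.
Proof.
rewrite /comb mulr_sumr -big_split; apply: eq_bigr => i _.
by rewrite rmorphD rmorphM mulrDl mulrA.
Qed.

Lemma comb0 (I : finType) (v : I -> A) : comb v (fun=> 0) = 0.
Proof. by rewrite /comb big1 // => i _; rewrite rmorph0 mul0r. Qed.

Lemma comb_delta (I : finType) (v : I -> A) i :
  comb v (fun j => (j == i)%:R) = v i.
Proof.
rewrite /comb (bigD1 i) //= eqxx rmorph1 mul1r big1 ?addr0 // => j /negPf->.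
by rewrite rmorph0 mul0r.
Qed.

Lemma spanned_subspace (I : finType) (v : I -> A) : subspace (spanned v).
Proof.
split=> [|x _ _ [c ->] [d ->]]; first by exists (fun=> 0); rewrite comb0.
by exists (fun i => x * c i + d i); rewrite combP.
Qed.

Lemma spanned_gen (I : finType) (v : I -> A) i : spanned v (v i).
Proof. by exists (fun j => (j == i)%:R); rewrite comb_delta. Qed.

Lemma spanned_sub (I : finType) (v : I -> A) U :
  subspace U -> (forall i, U (v i)) -> forall a, spanned v a -> U a.
Proof.
by move=> hU Uv _ [c ->]; apply: subspace_sum => // i _; apply: subspaceZ.
Qed.

Lemma free_uniq (I : finType) (v : I -> A) c d :
  free_family v -> comb v c = comb v d -> c =1 d.
Proof.
move=> free_v eq_cd i; apply/eqP; rewrite -subr_eq0; apply/eqP.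
apply: (free_v (fun i => c i - d i)).
rewrite -[RHS](subrr (comb v c)) {2}eq_cd /comb -sumrB; apply: eq_bigr => j _.
by rewrite rmorphB mulrBl.
Qed.

(** The exchange lemma, read off the kernel of the matrix of coordinates. *)
Lemma free_card_le (I J : finType) (v : I -> A) (w : J -> A) :
  (forall j, spanned v (w j)) -> free_family w -> (#|J| <= #|I|)%N.
Proof.
move=> /choice[c wE] free_w; rewrite leqNgt; apply/negP => ltIJ.
pose M : 'M[k]_(#|J|, #|I|) := \matrix_(j, i) c (enum_val j) (enum_val i).
have [r0 r0M] : exists2 r : 'rV[k]_#|J|, r != 0 & r *m M = 0.
  have : kermx M != 0.
    rewrite kermx_eq0 /row_free; apply: contraTneq ltIJ => <-.
    by rewrite -leqNgt rank_leq_col.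
  by case/rowV0Pn=> r /sub_kermxP rM r0; exists r.
move=> rM; case/negP: r0M; apply/eqP/rowP => j; rewrite mxE.
pose d j := r0 0 (enum_rank j).
rewrite -[j]enum_valK -[LHS]/(d _); apply: free_w; rewrite /comb.
under eq_bigr do rewrite wE /comb mulr_sumr.
rewrite exchange_big big1 //= => i _.
under eq_bigr do rewrite mulrA -rmorphM.
rewrite -mulr_suml -rmorph_sum /=.
have := congr1 (fun N : 'rV_ _ => N 0 (enum_rank i)) rM; rewrite !mxE.
rewrite (reindex (@enum_rank J)) /=; last first.
  by exists enum_val => ? _; rewrite (enum_rankK, enum_valK).
under eq_bigr do rewrite mxE !enum_rankK.
by move->; rewrite rmorph0 mul0r.
Qed.

Definition extend_family (I : finType) (v : I -> A) a (s : I + unit) : A :=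
  if s is inl i then v i else a.

Lemma free_extend (I : finType) (v : I -> A) a :
  free_family v -> ~ spanned v a -> free_family (extend_family v a).
Proof.
move=> free_v nva c; rewrite /comb big_sumType /= (big_pred1 tt) /=; last by case.
have [c0|c_neq0] := eqVneq (c (inr tt)) 0.
  rewrite c0 rmorph0 mul0r addr0 => /free_v vc0.
  by case=> [i|[]] //; apply: vc0.
move=> /eqP; rewrite addr_eq0 => /eqP vcE; case: nva.
exists (fun i => - (c (inr tt))^-1 * c (inl i)).
have := combP v (- (c (inr tt))^-1) (fun i => c (inl i)) (fun=> 0).
rewrite comb0 addr0 {2}/comb vcE rmorphN mulrNN mulrA -rmorphM mulVf //.
rewrite rmorph1 mul1r => <-; congr (comb v _); apply/funext => i.
by rewrite addr0.
Qed.

(** A free family of largest size in a subspace spans it. *)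
Lemma basis_exists U n : subspace U ->
    (forall (I : finType) (v : I -> A),
      (forall i, U (v i)) -> free_family v -> (#|I| <= n)%N) ->
  exists (I : finType) (v : I -> A),
    [/\ forall i, U (v i), free_family v & forall a, U a -> spanned v a].
Proof.
move=> hU le_n.
pose P m := `[< exists (I : finType) (v : I -> A),
  [/\ #|I| = m, forall i, U (v i) & free_family v] >].
have exP : exists m, P m.
  exists 0%N; apply/asboolP; exists void, (fun i : void => 0).
  by split=> [||c _ []]; rewrite ?card_void //; case.
have leP m : P m -> (m <= n)%N.
  by move=> /asboolP[I [v [<- Uv free_v]]]; apply: le_n free_v.
case: (ex_maxnP exP leP) => m /asboolP[I [v [cardI Uv free_v]]] max_m.
exists I, v; split=> // a Ua; apply: contrapT => nva.
have /max_m : P m.+1; last by rewrite ltnn.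
apply/asboolP; exists (I + unit)%type, (extend_family v a).
split; [by rewrite card_sum card_unit cardI addn1 | by case | exact: free_extend].
Qed.

(** A complement of [U] is a subspace that is maximal among those that meet [U]
    in zero. *)
Lemma complement_exists U : subspace U ->
  exists W, [/\ subspace W, forall a, U a -> W a -> a = 0 &
    forall a, exists u w, [/\ U u, W w & a = u + w]].
Proof.
move=> hU; pose closed W := forall x a b, W a -> W b -> W (kalg_str A x * a + b).
pose P (W : set A) := closed W /\ forall a, U a -> W a -> a = 0.
have [F FP totF|W [[clW UW0] maxW]] := @Zorn_bigcup A P.
  split=> [x a b [X FX Xa] [Y FY Yb]|a Ua [X FX]]; last by case: (FP X FX) => _; apply.
  have [XY|YX] := totF _ _ FX FY; [exists Y | exists X] => //.
    by case: (FP Y FY) => clY _; apply: clY => //; apply: XY.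
  by case: (FP X FX) => clX _; apply: clX => //; apply: YX.
have grow W' : P W' -> (forall a, W a -> W' a) -> forall a, W' a -> W a.
  move=> PW' WW' a W'a; apply: contrapT => nWa; apply: (maxW W') => //.
  by split=> // W'W; apply: nWa; apply: W'W.
(* [P] does not require zero to be a member, as the union of the empty chain is
   empty; maximality restores it. *)
have W0 : W 0.
  apply: (grow (fun a => a = 0 \/ W a)) => [|a|]; [|by right|by left].
  split=> [x a b [->|Wa] [->|Wb]|a Ua [//|]]; last exact: UW0.
  - by left; rewrite mulr0 addr0.
  - by right; rewrite mulr0 add0r.
  - right; rewrite addr0; suff W0 : W 0 by rewrite -[_ * _]addr0; apply: clW.
    by rewrite -(addNr a) -mulN1r -(rmorphN1 (kalg_str A)); apply: clW.
  - by right; apply: clW.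
have hW : subspace W by split.
exists W; split=> // a; apply: contrapT => na.
have Wa : W a; last first.
  by apply: na; exists 0, a; split=> //; [case: hU | rewrite add0r].
apply: (grow (fun b => exists x w, W w /\ b = kalg_str A x * a + w)); last first.
- by exists 1, 0; rewrite rmorph1 mul1r addr0.
- by move=> b Wb; exists 0, b; rewrite rmorph0 mul0r add0r.
split=> [x _ _ [y [w [Ww ->]]] [z [w' [Ww' ->]]]|b Ub [x [w [Ww bE]]]].
  exists (x * y + z), (kalg_str A x * w + w'); split; first exact: clW.
  by rewrite mulrDr addrACA !mulrA -rmorphM -mulrDl -rmorphD.
have [x0|x_neq0] := eqVneq x 0.
  by apply: UW0 => //; rewrite bE x0 rmorph0 mul0r add0r.
case: na; exists (kalg_str A x^-1 * b), (- (kalg_str A x^-1 * w)); split.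
- exact: subspaceZ.
- by apply: subspaceN => //; apply: subspaceZ.
- by rewrite -mulrBr bE addrK mulrA -rmorphM mulVf // rmorph1 mul1r.
Qed.

Lemma retraction_exists U : subspace U ->
  exists p : A -> A, [/\ forall a, U (p a), forall a, U a -> p a = a &
    forall x a b, p (kalg_str A x * a + b) = kalg_str A x * p a + p b].
Proof.
move=> hU; have [W [hW UW0 dec]] := complement_exists hU.
have /choice[p pP] : forall a, exists u, U u /\ W (a - u).
  by move=> a; have [u [w [Uu Ww ->]]] := dec a; exists u; rewrite addrC addKr.
have uniq a u : U u -> W (a - u) -> p a = u.
  move=> Uu Wu; have [Up Wp] := pP a; apply/eqP; rewrite -subr_eq0; apply/eqP.
  apply: UW0; first by apply: subspaceD => //; apply: subspaceN.
  have -> : p a - u = (a - u) - (a - p a).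
    by rewrite opprB [RHS]addrC addrA subrK.
  by apply: subspaceD => //; apply: subspaceN.
exists p; split=> [a|a Ua|x a b]; first by case: (pP a).
  by apply: uniq => //; rewrite subrr; case: hW.
have [[Ua Wa] [Ub Wb]] := (pP a, pP b); apply: uniq; first by apply hU.2.
by rewrite opprD addrACA -mulrBr; apply hW.2.
Qed.

Definition finite_dimensional : Prop :=
  exists (I : finType) (v : I -> A), forall a, spanned v a.

Lemma finite_dimensional_basis : finite_dimensional ->
  exists (I : finType) (v : I -> A), free_family v /\ forall a, spanned v a.
Proof.
case=> I [v span_v].
have [||J [w [_ free_w span_w]]] := @basis_exists (fun=> True) #|I|.
- by split.
- by move=> J w _; apply: free_card_le => j; apply: span_v.
- by exists J, w; split=> // a; apply: span_w.
Qed.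

End LinearAlgebra.

(** * Separability idempotents *)

Definition balanced (k : fieldType) (A : kalg k) (W : zmodType)
    (f : A -> A -> W) : Prop :=
  [/\ forall b, {morph f^~ b : a a' / a + a'}, forall a, {morph f a : b b' / b + b'} &
      forall x a b, f (kalg_str A x * a) b = f a (kalg_str A x * b)].

(** The families [a] and [b] stand for the tensor [\sum_i a i (x) b i] in the
    square of [A]; its invariance under [c (x) 1 - 1 (x) c] is tested against all
    balanced maps, which avoids the construction of that tensor square. *)
Definition tensor_invariant (k : fieldType) (A : kalg k) (I : finType)
    (a b : I -> A) (c : A) : Prop :=
  forall (W : zmodType) (f : A -> A -> W), balanced f ->
    \sum_i f (c * a i) (b i) = \sum_i f (a i) (c * b i).

Definition separability_idempotent (k : fieldType) (A : kalg k) (I : finType)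
    (a b : I -> A) : Prop :=
  \sum_i a i * b i = 1 /\ forall c, tensor_invariant a b c.

Definition separable_algebra (k : fieldType) (A : kalg k) : Prop :=
  exists (I : finType) (a b : I -> A), separability_idempotent a b.

Definition field_kalg (k : fieldType) (L : fieldExtType k) : kalg k :=
  KAlg (GRing.in_alg L).

Section Balanced.

Variables (k : fieldType) (A : kalg k) (W : zmodType) (f : A -> A -> W).
Hypothesis f_bal : balanced f.

Lemma balancedDl a a' b : f (a + a') b = f a b + f a' b.
Proof. by case: f_bal => /(_ b). Qed.

Lemma balancedDr a b b' : f a (b + b') = f a b + f a b'.
Proof. by case: f_bal => _ /(_ a). Qed.

Lemma balanced0l b : f 0 b = 0.
Proof. by apply: (addIr (f 0 b)); rewrite -balancedDl !add0r. Qed.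

Lemma balanced0r a : f a 0 = 0.
Proof. by apply: (addIr (f a 0)); rewrite -balancedDr !add0r. Qed.

Lemma balancedBr a b b' : f a (b - b') = f a b - f a b'.
Proof. by apply/eqP; rewrite eq_sym subr_eq -balancedDr subrK. Qed.

Lemma balanced_suml (I : Type) (r : seq I) (P : pred I) (F : I -> A) b :
  f (\sum_(i <- r | P i) F i) b = \sum_(i <- r | P i) f (F i) b.
Proof.
by apply: (big_morph (f^~ b)) => [a a'|]; rewrite ?balancedDl ?balanced0l.
Qed.

Lemma balanced_mul c d : balanced (fun a b => f (c * a) (d * b)).
Proof.
split=> [b a a'|a b b'|x a b]; first by rewrite mulrDr balancedDl.
  by rewrite mulrDr balancedDr.
by rewrite mulrCA [in RHS]mulrCA; case: f_bal => _ _ ->.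
Qed.

End Balanced.

Section TensorInvariant.

Variables (k : fieldType) (A : kalg k) (I : finType) (a b : I -> A).

Lemma tensor_invariant_str x : tensor_invariant a b (kalg_str A x).
Proof. by move=> W f [_ _ hf]; apply: eq_bigr => i _; apply: hf. Qed.

Lemma tensor_invariantM c d :
  tensor_invariant a b c -> tensor_invariant a b d -> tensor_invariant a b (c * d).
Proof.
move=> hc hd W f hf.
have := hd _ _ (balanced_mul hf c 1); have := hc _ _ (balanced_mul hf 1 d).
under eq_bigr do rewrite mul1r; under [X in _ = X -> _]eq_bigr do rewrite mul1r.
move=> e2; under eq_bigr do rewrite mul1r mulrA.
under [X in _ = X -> _]eq_bigr do rewrite mul1r.
rewrite e2 => ->.
by apply: eq_bigr => i _; rewrite mulrCA mulrA.
Qed.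

Lemma tensor_invariantD c d :
  tensor_invariant a b c -> tensor_invariant a b d -> tensor_invariant a b (c + d).
Proof.
move=> hc hd W f hf; under eq_bigr do rewrite mulrDl (balancedDl hf).
under [RHS]eq_bigr do rewrite mulrDl (balancedDr hf).
by rewrite !big_split hc // hd.
Qed.

Lemma tensor_invariantB c d :
  tensor_invariant a b c -> tensor_invariant a b d -> tensor_invariant a b (c - d).
Proof.
move=> hc hd; apply: tensor_invariantD => //.
rewrite -mulN1r -(rmorphN1 (kalg_str A)).
exact: tensor_invariantM (tensor_invariant_str _) hd.
Qed.

End TensorInvariant.

(** Let [z] be a primitive element, [q] its minimal polynomial and
    [q = h * ('X - z)]. The tensor [\sum_i z^i (x) h_i / q'(z)], Euler's formula
    for the dual basis of the powers of [z], has product [h(z) / q'(z) = 1], and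
    [z (x) 1 - 1 (x) z] multiplies it to [q(z) (x) 1 / q'(z) = 0]. *)
Lemma separable_fieldExt (k : fieldType) (L : fieldExtType k) :
  separable 1%VS {:L} -> separable_algebra (field_kalg L).
Proof.
move=> sepL; set A := field_kalg L.
have defL := eq_adjoin_separable_generator sepL (sub1v _).
set z := separable_generator 1 {:L} in defL.
pose q := minPoly 1 z; pose h := q %/ ('X - z%:P).
have qE : q = h * ('X - z%:P).
  by rewrite /h divpK // dvdp_XsubCl root_minPoly.
have [t t_neq0 hz] : exists2 t, t != 0 & h.[z] = t.
  exists q^`().[z]; last first.
    by rewrite qE derivM derivB derivX derivC subr0 mulr1 hornerD hornerM
      hornerXsubC subrr mulr0 add0r.
  have := separable_root_der 1%AS z.
  by rewrite separable_generatorP /= => /negbTE/negbT.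
have q_neq0 : q != 0 by rewrite monic_neq0 ?monic_minPoly.
have szh : (size h < size q)%N.
  have h_neq0 : h != 0 by apply: contraNneq q_neq0 => h0; rewrite qE h0 mul0r.
  by rewrite qE size_Mmonic ?monicXsubC // size_XsubC addn2.
pose a (i : 'I_(size q)) : A := z ^+ i.
pose b (i : 'I_(size q)) : A := h`_i / t.
exists 'I_(size q), a, b; split.
  rewrite /a /b; under eq_bigr do rewrite mulrA [z ^+ _ * _]mulrC.
  by rewrite -mulr_suml -horner_coef_wide 1?ltnW // hz mulfV.
have invz : tensor_invariant a b z.
  move=> W f hf; apply/eqP; rewrite -subr_eq0 -sumrB; apply/eqP.
  have hX : \sum_i f (z * a i) (b i)
      = \sum_(i < size q) f (z ^+ i) ((h * 'X)`_i / t).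
    (* the coefficient of degree [(size q).-1] of [h] is zero *)
    have [n szq] : exists n, size q = n.+1.
      by exists (size q).-1; rewrite prednK // lt0n size_poly_eq0.
    rewrite /a /b; move: szh; rewrite szq ltnS => szh.
    rewrite big_ord_recr big_ord_recl /= coefMX /= mul0r balanced0r // add0r.
    rewrite nth_default // mul0r balanced0r // addr0.
    by apply: eq_bigr => i _; rewrite -exprS coefMX.
  rewrite sumrB hX -sumrB.
  have hq (i : 'I_(size q)) : exists x : k, q`_i = x%:A.
    by have /polyOverP/(_ i)/vlineP[x ->] := minPolyOver 1%AS z; exists x.
  transitivity (f q.[z] (1 / t)); last first.
    by rewrite minPolyxx (balanced0l hf).
  rewrite horner_coef; transitivity
    (\sum_(i < size q) f (q`_i * z ^+ i) (1 / t)); last first.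
    exact/esym/(balanced_suml hf).
  apply: eq_bigr => i _.
  have [x qx] := hq i; rewrite qx /a /b -(balancedBr hf).
  case: hf => _ _ hf; rewrite (hf x) -[kalg_str A x]/(x%:A) -qx; congr (f _ _).
  rewrite mulrA -mulrBl mul1r; congr (_ / _).
  by rewrite {3}qE mulrBr coefB coefMC; rewrite [z * _]mulrC.
move=> c; have : (c : L) \in {:L}%VS := memvf (c : L).
rewrite defL => /Fadjoin_polyP[p /polyOverP p1 ->].
rewrite horner_coef; apply: (big_ind (tensor_invariant a b)) => [||i _].
- by have := tensor_invariant_str a b 0; rewrite rmorph0.
- exact: tensor_invariantD.
have /vlineP[x ->] := p1 i; apply: tensor_invariantM; first exact: tensor_invariant_str.
elim: (i : nat) => [|m IH]; last by rewrite exprS; apply: tensor_invariantM.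
by have := tensor_invariant_str a b 1; rewrite rmorph1.
Qed.

Section ProductInclusions.

Variables (k : fieldType) (A : kalg k) (n : nat) (L : 'I_n -> fieldExtType k).
Variable pr : forall i, {rmorphism A -> L i}.
Hypothesis pr_bij : forall y : (forall i, L i), exists! a : A, forall i, pr i a = y i.

Lemma product_inj a a' : (forall i, pr i a = pr i a') -> a = a'.
Proof.
move=> eq_a; have [b [_ b_uniq]] := pr_bij (fun i => pr i a').
by rewrite -(b_uniq a) // -(b_uniq a').
Qed.

Lemma product_inclusions : exists io : forall i, L i -> A,
  [/\ forall i y, pr i (io i y) = y,
      forall i j y, j != i -> pr j (io i y) = 0,
      forall i y z, io i (y + z) = io i y + io i z &
      forall i a y, a * io i y = io i (pr i a * y)].
Proof.
have lift_ex (y : forall i, L i) : {a : A | forall i, pr i a = y i}.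
  by apply: cid; have [a [aE _]] := pr_bij y; exists a.
pose io i (y : L i) : A := sval (lift_ex (dfwith (fun j => 0 : L j) y)).
have ioE i y : pr i (io i y) = y.
  by rewrite /io; case: (lift_ex _) => a ->; rewrite dfwith_in.
have io0 i j y : j != i -> pr j (io i y) = 0.
  by move=> ji; rewrite /io; case: (lift_ex _) => a ->; rewrite dfwith_out // eq_sym.
exists io; split=> // [i y z|i a y]; apply: product_inj => j.
  rewrite rmorphD; have [->|ji] := eqVneq j i; first by rewrite !ioE.
  by rewrite !io0 // addr0.
rewrite rmorphM; have [->|ji] := eqVneq j i; first by rewrite !ioE.
by rewrite !io0 // mulr0.
Qed.

End ProductInclusions.

(** A separability idempotent of a product is assembled from those of the
    factors, moved along the inclusions of the factors. *)
Lemma etale_separable (k : fieldType) (A : kalg k) :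
  etale A -> separable_algebra A.
Proof.
case=> n [L [pr [sepL prk bij]]].
have [io [ioE io0 ioD ioA]] := product_inclusions bij.
have ioZ i x y : kalg_str A x * io i y = io i (x%:A * y) by rewrite ioA prk.
have datum i : {I : finType & {ab : (I -> L i) * (I -> L i) |
    @separability_idempotent k (field_kalg (L i)) I ab.1 ab.2}}.
  have [I IP] := cid (separable_fieldExt (sepL i)); exists I.
  have [a /cid[b ab]] := cid IP; by exists (a, b).
pose I i := projT1 (datum i).
pose a i : I i -> L i := (sval (projT2 (datum i))).1.
pose b i : I i -> L i := (sval (projT2 (datum i))).2.
have ab i : @separability_idempotent k (field_kalg (L i)) (I i) (a i) (b i).
  exact: svalP (projT2 (datum i)).
exists {i : 'I_n & I i}, (fun s => io (tag s) (a (tag s) (tagged s))),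
  (fun s => io (tag s) (b (tag s) (tagged s))).
have sumE (W : nmodType) (F : forall i, I i -> W) :
    \sum_(s : {i : 'I_n & I i}) F (tag s) (tagged s) = \sum_i \sum_(j : I i) F i j.
  by rewrite sig_big_dep.
split.
  rewrite (sumE _ (fun i j => io i (a i j) * io i (b i j))).
  apply: (product_inj bij) => i; rewrite rmorph_sum rmorph1 (bigD1 i) //=.
  rewrite [X in _ + X]big1 => [|j ji]; last first.
    rewrite rmorph_sum big1 // => l _.
    by rewrite rmorphM !io0 ?mulr0 // eq_sym.
  rewrite addr0 rmorph_sum -[RHS](ab i).1; apply: eq_bigr => j _.
  by rewrite rmorphM !ioE.
move=> c W f hf.
rewrite (sumE _ (fun i j => f (c * io i (a i j)) (io i (b i j)))).
rewrite (sumE _ (fun i j => f (io i (a i j)) (c * io i (b i j)))).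
apply: eq_bigr => i _.
have hfi : @balanced k (field_kalg (L i)) W (fun y z => f (io i y) (io i z)).
  split=> [z y y'|z y y'|x y z] /=.
  - by rewrite ioD (balancedDl hf).
  - by rewrite ioD (balancedDr hf).
  - by case: hf => _ _ hf; rewrite -!ioZ hf.
under eq_bigr do rewrite ioA; under [RHS]eq_bigr do rewrite ioA.
exact: (ab i).2 (pr i c) _ _ hfi.
Qed.

Lemma etale_finite_dimensional (k : fieldType) (A : kalg k) :
  etale A -> finite_dimensional A.
Proof.
case=> n [L [pr [sepL prk bij]]].
have [io [ioE io0 ioD ioA]] := product_inclusions bij.
have ioZ i x y : kalg_str A x * io i y = io i (x *: y).
  by rewrite ioA prk mulr_algl.
have io00 i : io i 0 = 0 by apply: (addIr (io i 0)); rewrite -ioD !add0r.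
pose e i (j : 'I_(\dim {:L i})) : L i := (vbasis {:L i})`_j.
exists {i : 'I_n & 'I_(\dim {:L i})}, (fun s => io (tag s) (e (tag s) (tagged s))).
move=> a; exists (fun s => coord (vbasis {:L (tag s)}) (tagged s) (pr (tag s) a)).
pose F i (j : 'I_(\dim {:L i})) :=
  kalg_str A (coord (vbasis {:L i}) j (pr i a)) * io i (e i j).
transitivity (\sum_i \sum_j F i j); last by rewrite sig_big_dep.
have ioS i (J : finType) (G : J -> L i) : io i (\sum_j G j) = \sum_j io i (G j).
  exact: (big_morph (io i) (ioD i)).
transitivity (\sum_i io i (pr i a)).
  apply: (product_inj bij) => i; rewrite rmorph_sum (bigD1 i) //= ioE big1 ?addr0 //.
  by move=> j ji; rewrite io0 // eq_sym.
apply: eq_bigr => i _; rewrite /F; under eq_bigr do rewrite ioZ.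
by rewrite -ioS -coord_vbasis // memvf.
Qed.

Section Averaging.

Variables (k k0 : fieldType) (A0 : kalg k0) (A : kalg k).
Variables (s : k0 -> k) (h : {rmorphism A0 -> A}).
Hypothesis h_semilinear : forall x, h (kalg_str A0 x) = kalg_str A (s x).

(** Maschke's averaging: over a separable algebra, a linear retraction becomes
    equivariant once it is averaged against the separability idempotent. *)
Lemma equivariant_retraction (U : A -> Prop) :
    separable_algebra A0 -> subspace U -> (forall c a, U a -> U (h c * a)) ->
  exists q : A -> A, [/\ forall a, U (q a), forall a, U a -> q a = a,
    forall x a b, q (kalg_str A x * a + b) = kalg_str A x * q a + q b &
    forall c a, q (h c * a) = h c * q a].
Proof.
case=> I [a [b [ab1 ab]]] hU Uh.
have [p [Up pU pL]] := retraction_exists hU.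
have pD x y : p (x + y) = p x + p y.
  by have := pL 1 x y; rewrite rmorph1 !mul1r.
have p0 : p 0 = 0 by apply: (addIr (p 0)); rewrite -pD !add0r.
have pZ x y : p (kalg_str A x * y) = kalg_str A x * p y.
  by have := pL x y 0; rewrite p0 !addr0.
exists (fun z => \sum_i h (a i) * p (h (b i) * z)); split.
- by move=> z; apply: subspace_sum => // i _; apply: Uh.
- move=> z Uz; rewrite -[RHS]mul1r -(rmorph1 h) -ab1 rmorph_sum mulr_suml.
  by apply: eq_bigr => i _; rewrite pU ?rmorphM ?mulrA //; apply: Uh.
- move=> x y z; rewrite mulr_sumr -big_split; apply: eq_bigr => i _ /=.
  by rewrite mulrDr pD mulrCA pZ mulrDr mulrCA.
move=> c z; have bal : balanced (fun x y : A0 => h x * p (h y * z)).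
  split=> [y x x'|x y y'|x y y'].
  - by rewrite rmorphD mulrDl.
  - by rewrite rmorphD mulrDl pD mulrDr.
  - by rewrite !rmorphM h_semilinear -!mulrA pZ mulrCA.
rewrite mulr_sumr; have /esym := ab c _ _ bal.
under eq_bigr do rewrite rmorphM -mulrA mulrCA.
under [X in _ = X -> _]eq_bigr do rewrite rmorphM -mulrA.
by move=> <-; apply: eq_bigr => i _; rewrite mulrCA.
Qed.

End Averaging.

(** Each ideal of a separable algebra has an equivariant retraction [q], hence is
    generated by the idempotent [q 1]. *)
Lemma separable_regular (k : fieldType) (A : kalg k) (c : A) :
  separable_algebra A -> exists y, c = c * c * y.
Proof.
move=> sepA; pose U (a : A) := exists y, a = c * y.
have hU : subspace U.
  split=> [|x _ _ [y ->] [z ->]]; first by exists 0; rewrite mulr0.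
  by exists (kalg_str A x * y + z); rewrite mulrDr mulrCA.
have Uid d a : U a -> U (d * a) by case=> y ->; exists (d * y); rewrite mulrCA.
have [q [Uq qU _ qM]] :=
  equivariant_retraction (h := idfun) (s := id) (fun=> erefl) sepA hU Uid.
have [y q1] := Uq 1; exists y.
rewrite -mulrA -q1 -[c * q 1](qM c) mulr1 qU //.
by exists 1; rewrite mulr1.
Qed.

Section OrthogonalIdempotents.

Variables (k : fieldType) (A : kalg k).

Definition orthogonal_idempotents (I : finType) (e : I -> A) : Prop :=
  (forall i, e i != 0) /\ forall i j, e i * e j = if i == j then e i else 0.

Lemma orthogonal_free (I : finType) (e : I -> A) :
  orthogonal_idempotents e -> free_family e.
Proof.
move=> [e_neq0 ee] c ce0 i; apply/eqP/contraT => ci_neq0.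
case/eqP: (e_neq0 i).
have := congr1 (fun a => kalg_str A (c i)^-1 * (e i * a)) ce0.
rewrite /comb !mulr0 mulr_sumr (bigD1 i) //= big1 => [|j ji]; last first.
  by rewrite mulrCA ee eq_sym (negPf ji) mulr0.
by rewrite addr0 [e i * _]mulrCA ee eqxx mulrA -rmorphM mulVf // rmorph1 mul1r.
Qed.

(** A largest orthogonal family of idempotents is complete, and none of its
    members splits: in a regular ring each corner is then a field. *)
Lemma primitive_idempotents :
    finite_dimensional A -> separable_algebra A ->
  exists (I : finType) (e : I -> A), [/\ orthogonal_idempotents e,
    \sum_i e i = 1 & forall i x, x * e i != 0 -> exists y, x * y * e i = e i].
Proof.
move=> [J [v span_v]] sepA.
pose P m := `[< exists (I : finType) (e : I -> A),
  #|I| = m /\ orthogonal_idempotents e >].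
have exP : exists m, P m.
  exists 0%N; apply/asboolP; exists void, (fun i : void => 0).
  by rewrite card_void; split=> //; split=> [] [].
have leP m : P m -> (m <= #|J|)%N.
  move=> /asboolP[I [e [<- /orthogonal_free free_e]]].
  by apply: free_card_le free_e => i; apply: span_v.
case: (ex_maxnP exP leP) => m /asboolP[I [e [cardI [e_neq0 ee]]]] max_m.
have no_extension (e' : I + unit -> A) : ~ orthogonal_idempotents e'.
  move=> he'; have /max_m : P m.+1; last by rewrite ltnn.
  apply/asboolP; exists (I + unit)%type, e'; split=> //.
  by rewrite card_sum card_unit cardI addn1.
have eS i : e i * \sum_j e j = e i.
  rewrite mulr_sumr (bigD1 i) //= ee eqxx big1 ?addr0 // => j ji.
  by rewrite ee eq_sym (negPf ji).
exists I, e; split=> // [|i x xe_neq0].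
  apply/eqP; rewrite eq_sym -subr_eq0; apply: contraT => s_neq0.
  case: (no_extension (extend_family e (1 - \sum_i e i))); split.
    by case.
  have SS : (\sum_j e j) * (\sum_j e j) = \sum_j e j.
    by rewrite mulr_suml; apply: eq_bigr => j _; rewrite eS.
  case=> [i|[]] [j|[]] /=.
  - by rewrite ee.
  - by rewrite mulrBr mulr1 eS subrr.
  - by rewrite mulrC mulrBr mulr1 eS subrr.
  - by rewrite mulrBr mulr1 mulrBl mul1r SS subrr subr0.
have [y cE] := separable_regular (x * e i) sepA; set c := x * e i in cE xe_neq0.
have ce : c * e i = c by rewrite /c -mulrA ee eqxx.
pose f := c * y.
have fe : f * e i = f by rewrite /f mulrAC ce.
have ff : f * f = f by rewrite /f mulrACA mulrA -cE.
have f_neq0 : f != 0 by apply: contraNneq xe_neq0 => f0; rewrite cE -mulrA -/f f0 mulr0.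
have [fE|f_neqe] := eqVneq f (e i).
  by exists y; rewrite mulrAC -/c -fE.
have fej j : j != i -> f * e j = 0.
  by move=> ji; rewrite -fe -mulrA ee eq_sym (negPf ji) mulr0.
pose e1 j := if j == i then e i - f else e j.
case: (no_extension (extend_family e1 f)); split.
  case=> [j|[]] //=; rewrite /e1; have [_|//] := eqVneq j i.
  by rewrite subr_eq0 eq_sym.
have ge (g : A) : g = f \/ g = e i -> e i * g = g.
  by case=> ->; rewrite ?ee ?eqxx // mulrC.
case=> [j|[]] [l|[]] /=; rewrite /e1.
- rewrite (inj_eq (@inl_inj _ _)); have [->|ji] := eqVneq j i.
    have [_|li] := eqVneq l i.
      rewrite mulrBr mulrBl ee eqxx mulrBl [e i * f]mulrC fe ff subrr subr0.
      by [].
    by rewrite mulrBl fej // ee eq_sym (negPf li) subr0.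
  have [->|li] := eqVneq l i.
    by rewrite (negPf ji) mulrBr ee (negPf ji) mulrC fej // subr0.
  by rewrite ee.
- have [_|ji] := eqVneq j i; last by rewrite mulrC fej.
  by rewrite mulrBl mulrC fe ff subrr.
- have [_|li] := eqVneq l i; last by rewrite fej.
  by rewrite mulrBr fe ff subrr.
- by [].
Qed.

End OrthogonalIdempotents.

(** A corner has unit [e], not [1]: it is the quotient of the ring by [1 - e],
    carried by the multiples of [e]. *)
Record idempotent (R : comPzRingType) :=
  Idempotent { idem_val : R; idemP : idem_val * idem_val = idem_val }.

Section Corner.

Variables (R : comPzRingType) (e0 : idempotent R).
Local Notation e := (idem_val e0).

Record corner := CornerElt { corner_val : R; cornerP : corner_val * e == corner_val }.

HB.instance Definition _ := [isSub for corner_val].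
HB.instance Definition _ := [Choice of corner by <:].

Definition to_corner (a : R) : corner.
Proof. by exists (a * e); rewrite -mulrA idemP. Defined.

Lemma corner_valK (x : corner) : to_corner (corner_val x) = x.
Proof. by apply: val_inj => /=; apply/eqP/cornerP. Qed.

Lemma corner_mule (x : corner) : corner_val x * e = corner_val x.
Proof. exact/eqP/cornerP. Qed.

Definition corner_add x y := to_corner (corner_val x + corner_val y).
Definition corner_mul x y := to_corner (corner_val x * corner_val y).
Definition corner_opp x := to_corner (- corner_val x).

Lemma corner_addE x y : corner_val (corner_add x y) = corner_val x + corner_val y.
Proof. by rewrite /= mulrDl !corner_mule. Qed.
Lemma corner_mulE x y : corner_val (corner_mul x y) = corner_val x * corner_val y.
Proof. by rewrite /= -mulrA corner_mule. Qed.
Lemma corner_oppE x : corner_val (corner_opp x) = - corner_val x.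
Proof. by rewrite /= mulNr corner_mule. Qed.

Lemma corner_addA : associative corner_add.
Proof.
by move=> x y z; apply: val_inj; rewrite [LHS]corner_addE [RHS]corner_addE;
  rewrite !corner_addE addrA.
Qed.
Lemma corner_addC : commutative corner_add.
Proof. by move=> x y; apply: val_inj; rewrite /= addrC. Qed.
Lemma corner_add0 : left_id (to_corner 0) corner_add.
Proof. by move=> x; apply: val_inj; rewrite [LHS]corner_addE /= mul0r add0r. Qed.
Lemma corner_addN : left_inverse (to_corner 0) corner_opp corner_add.
Proof.
by move=> x; apply: val_inj; rewrite [LHS]corner_addE corner_oppE addNr /= mul0r.
Qed.

HB.instance Definition _ := GRing.isZmodule.Build corner
  corner_addA corner_addC corner_add0 corner_addN.

Lemma corner_mulA : associative corner_mul.
Proof.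
by move=> x y z; apply: val_inj; rewrite [LHS]corner_mulE [RHS]corner_mulE;
  rewrite !corner_mulE mulrA.
Qed.
Lemma corner_mulC : commutative corner_mul.
Proof. by move=> x y; apply: val_inj; rewrite /= [corner_val x * _]mulrC. Qed.
Lemma corner_mul1 : left_id (to_corner 1) corner_mul.
Proof.
by move=> x; apply: val_inj; rewrite [LHS]corner_mulE /= mul1r mulrC corner_mule.
Qed.
Lemma corner_mulD : left_distributive corner_mul corner_add.
Proof.
move=> x y z; apply: val_inj; rewrite [LHS]corner_mulE [RHS]corner_addE.
by rewrite !corner_mulE corner_addE mulrDl.
Qed.

HB.instance Definition _ := GRing.Zmodule_isComPzRing.Build corner
  corner_mulA corner_mulC corner_mul1 corner_mulD.

Lemma to_corner_zmod : zmod_morphism to_corner.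
Proof.
move=> a b; apply: val_inj; rewrite [RHS]corner_addE corner_oppE /=.
by rewrite mulrBl.
Qed.
Lemma to_corner_monoid : monoid_morphism to_corner.
Proof.
split=> // a b; apply: val_inj; rewrite [RHS]corner_mulE /=.
by rewrite mulrACA idemP.
Qed.

HB.instance Definition _ :=
  GRing.isZmodMorphism.Build R corner to_corner to_corner_zmod.
HB.instance Definition _ :=
  GRing.isMonoidMorphism.Build R corner to_corner to_corner_monoid.

End Corner.

Definition corner_kalg (k : fieldType) (A : kalg k) (e : idempotent A) : kalg k :=
  KAlg (to_corner e \o kalg_str A).

Section Quotients.

Variables (k : fieldType) (A B : kalg k) (h : {rmorphism A -> B}).
Hypotheses (h_hom : is_kalg_hom h) (h_surj : forall b, exists a, h a = b).

Lemma hom_comb (I : finType) (v : I -> A) c : h (comb v c) = comb (h \o v) c.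
Proof.
by rewrite /comb rmorph_sum; apply: eq_bigr => i _; rewrite rmorphM h_hom.
Qed.

Lemma quotient_finite_dimensional : finite_dimensional A -> finite_dimensional B.
Proof.
case=> I [v span_v]; exists I, (h \o v) => b; have [a <-] := h_surj b.
by have [c ->] := span_v a; exists c; rewrite hom_comb.
Qed.

Lemma quotient_separable : separable_algebra A -> separable_algebra B.
Proof.
case=> I [a [b [ab1 ab]]]; exists I, (h \o a), (h \o b); split.
  by rewrite -(rmorph1 h) -ab1 rmorph_sum; apply: eq_bigr => i _; rewrite rmorphM.
move=> c W f hf; have [d <-] := h_surj c.
have bal : balanced (fun x y : A => f (h x) (h y)).
  split=> [y x x'|x y y'|x y y'].
  - by rewrite rmorphD (balancedDl hf).
  - by rewrite rmorphD (balancedDr hf).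
  - by rewrite !rmorphM h_hom; case: hf => _ _ ->.
have := ab d _ _ bal.
under eq_bigr do rewrite rmorphM; under [X in _ = X -> _]eq_bigr do rewrite rmorphM.
by [].
Qed.

End Quotients.

(** * Separable algebras that are fields *)

(** The field extension structure below is attached to this record because it
    depends on the proofs that the record carries. *)
Record kfield (k : fieldType) := KField {
  kfield_kalg : kalg k;
  kfield_one_neq0 : (1 : kfield_kalg) != 0;
  kfield_inverse : forall x : kfield_kalg, x != 0 -> exists y, y * x = 1;
  kfield_fd : finite_dimensional kfield_kalg }.

Section FieldStructure.

Variables (k : fieldType) (F : kfield k).

Definition kfield_sort : Type := kfield_kalg F.

HB.instance Definition _ := GRing.ComPzRing.on kfield_sort.
HB.instance Definition _ :=
  GRing.PzSemiRing_isNonZero.Build kfield_sort (kfield_one_neq0 F).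

Lemma kfield_inv_ex (x : kfield_sort) :
  {y : kfield_sort | if x == 0 then y = 0 else y * x = 1}.
Proof.
apply: cid; case: eqVneq => [_|x_neq0]; first by exists 0.
exact: kfield_inverse.
Qed.

Definition kfield_inv (x : kfield_sort) : kfield_sort := sval (kfield_inv_ex x).

Lemma kfield_mulVf (x : kfield_sort) : x != 0 -> kfield_inv x * x = 1.
Proof. by rewrite /kfield_inv; case: (kfield_inv_ex x) => y /=; case: eqVneq. Qed.

Lemma kfield_inv0 : kfield_inv 0 = 0.
Proof. by rewrite /kfield_inv; case: (kfield_inv_ex 0) => y; rewrite eqxx. Qed.

HB.instance Definition _ :=
  GRing.ComNzRing_isField.Build kfield_sort kfield_mulVf kfield_inv0.

Definition kfield_scale (x : k) (a : kfield_sort) : kfield_sort :=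
  kalg_str (kfield_kalg F) x * a.

Lemma kfield_scaleA x y a : kfield_scale x (kfield_scale y a) = kfield_scale (x * y) a.
Proof. by rewrite /kfield_scale mulrA rmorphM. Qed.
Lemma kfield_scale1 : left_id 1 kfield_scale.
Proof. by move=> a; rewrite /kfield_scale rmorph1 mul1r. Qed.
Lemma kfield_scaleDr : right_distributive kfield_scale +%R.
Proof. by move=> x a b; rewrite /kfield_scale mulrDr. Qed.
Lemma kfield_scaleDl a : {morph kfield_scale^~ a : x y / x + y}.
Proof. by move=> x y; rewrite /kfield_scale rmorphD mulrDl. Qed.

HB.instance Definition _ := GRing.Zmodule_isLmodule.Build k kfield_sort
  kfield_scaleA kfield_scale1 kfield_scaleDr kfield_scaleDl.

Lemma kfield_scaleAl (x : k) (a b : kfield_sort) : x *: (a * b) = x *: a * b.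
Proof. exact: mulrA. Qed.
HB.instance Definition _ := GRing.Lmodule_isLalgebra.Build k kfield_sort kfield_scaleAl.
Lemma kfield_scaleAr (x : k) (a b : kfield_sort) : x *: (a * b) = a * (x *: b).
Proof. exact: mulrCA. Qed.
HB.instance Definition _ := GRing.Lalgebra_isAlgebra.Build k kfield_sort kfield_scaleAr.

Lemma kfield_vector_axiom : {n : nat & Vector.axiom n kfield_sort}.
Proof.
have [I /cid[v [free_v span_v]]] := cid (finite_dimensional_basis (kfield_fd F)).
have [c cE] := choice span_v.
exists #|I|, (fun a => \row_i c a (enum_val i)).
  move=> x a b; apply/rowP => i; rewrite !mxE.
  move: (enum_val i); apply: free_uniq free_v _.
  by rewrite -cE combP -!cE.
exists (fun r : 'rV_#|I| => comb v (fun i => r 0 (enum_rank i))) => [a|r].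
  rewrite [RHS]cE; congr (comb v _); apply/funext => i.
  by rewrite mxE enum_rankK.
apply/rowP => i; rewrite mxE.
rewrite (free_uniq free_v (esym (cE _)) (enum_val i)).
by rewrite enum_valK.
Qed.

HB.instance Definition _ :=
  Lmodule_hasFinDim.Build k kfield_sort (projT2 kfield_vector_axiom).

Definition kfield_ext : fieldExtType k := kfield_sort.

End FieldStructure.

(** A field extension with a separability idempotent has no nonzero derivation
    over the base. As Leibniz's rule is only assumed on [k(x)], a derivation is
    first extended to a connection, coordinatewise on a basis over [k(x)]. *)
Lemma separable_algebra_fieldExt (k : fieldType) (L : fieldExtType k) :
  separable_algebra (field_kalg L) -> separable 1%VS {:L}.
Proof.
case=> I [a [b [ab1 ab]]]; apply/separableP => x _.
apply/Derivation_separableP => D derD D1; set M := <<1; x>>%AS.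
pose LM : kalg (subvs_of M) := KAlg (vsval : {rmorphism subvs_of M -> L}).
have D0 c : D (c%:A) = 0.
  by apply/eqP; rewrite -memv_ker; apply: (subvP D1); rewrite memvZ ?mem1v.
have valA l : vsval (l%:A : subvs_of M) = l%:A by rewrite linearZ rmorph1.
have fdLM : finite_dimensional LM.
  exists 'I_(\dim {:L}), (fun i : 'I_(\dim {:L}) => (vbasis {:L})`_i : L) => y.
  have yE := coord_vbasis (memvf (y : L)).
  exists (fun i => (coord (vbasis {:L}) i (y : L))%:A).
  rewrite {1}yE; apply: eq_bigr => i _ /=.
  by rewrite algid1 mulr_algl.
have [J [u [free_u span_u]]] := finite_dimensional_basis fdLM.
have [c cE] := choice span_u.
(* the connection that is flat on the basis [u] *)
pose nabla (y : L) : L := \sum_j D (vsval (c y j)) * u j.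
have nablaP (m : subvs_of M) y z :
    nabla (vsval m * y + z) = D (vsval m) * y + vsval m * nabla y + nabla z.
  have cP :  c (vsval m * y + z) =1 (fun j => m * c y j + c z j).
    by apply: free_uniq free_u _; rewrite -cE combP -!cE.
  have -> : D (vsval m) * y = \sum_j D (vsval m) * (vsval (c y j) * u j).
    by rewrite -mulr_sumr; congr (_ * _); apply: cE.
  rewrite /nabla mulr_sumr -!big_split; apply: eq_bigr => j _ /=.
  rewrite cP rmorphD rmorphM linearD /=. rewrite (Derivation_mul derD) ?subvsP //=.
  by rewrite !mulrDl !mulrA.
have nablaD y z : nabla (y + z) = nabla y + nabla z.
  by have := nablaP 1 y z; rewrite rmorph1 !mul1r -{1}[1]scale1r D0 mul0r add0r.
have nabla0 : nabla 0 = 0 by apply: (addIr (nabla 0)); rewrite -nablaD !add0r.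
have bal : @balanced k (field_kalg L) L (fun y z : L => y * nabla z).
  split=> [z y y'|y z z'|l y z] /=.
  - by rewrite mulrDl.
  - by rewrite nablaD mulrDr.
  have := nablaP l%:A z 0; rewrite valA D0 mul0r add0r nabla0 !addr0 => ->.
  by rewrite mulrCA mulrA.
apply/subvP => m Mm; rewrite memv_ker; apply/eqP.
have mE : m = vsval (vsproj M m) by rewrite vsprojK.
have := ab m _ _ bal.
have -> : \sum_i a i * nabla (m * b i) = D m + \sum_i m * a i * nabla (b i).
  rewrite -[D m]mulr1 -[X in D m * X]ab1 mulr_sumr -big_split.
  apply: eq_bigr => i _ /=.
  have := nablaP (vsproj M m) (b i) 0; rewrite -mE nabla0 !addr0 => ->.
  by rewrite mulrDr mulrCA; congr (_ + _); rewrite mulrCA mulrA.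
by move=> /eqP; rewrite eq_sym -subr_eq0 addrK => /eqP.
Qed.

(** * Recognising etale algebras *)

(** The primitive idempotents of a separable algebra decompose it into fields,
    which inherit the separability idempotent. *)
Lemma etaleP (k : fieldType) (A : kalg k) :
  etale A <-> finite_dimensional A /\ separable_algebra A.
Proof.
split=> [etA|[fdA sepA]].
  by split; [apply: etale_finite_dimensional | apply: etale_separable].
have [I [e0 [[e_neq0 ee0] e01 e_inv0]]] := primitive_idempotents fdA sepA.
pose e (i : 'I_#|I|) := e0 (enum_val i).
have ee i j : e i * e j = if i == j then e i else 0.
  by rewrite /e ee0 (inj_eq enum_val_inj).
have e1 : \sum_i e i = 1.
  rewrite -e01 (reindex (@enum_val _ I)) //=.
  by exists enum_rank => ? _; rewrite (enum_rankK, enum_valK).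
have eeE i : e i * e i = e i by rewrite ee eqxx.
pose E (i : 'I_#|I|) : idempotent A := Idempotent (eeE i).
pose C i := corner_kalg (E i).
have C_hom i : @is_kalg_hom k A (C i) (to_corner (E i)) by move=> x.
have C_surj i (b : C i) : exists a, to_corner (E i) a = b.
  by exists (corner_val b); apply: corner_valK.
have fdC i : finite_dimensional (C i).
  exact: quotient_finite_dimensional (C_hom i) (C_surj i) fdA.
have sepC i : separable_algebra (C i) := quotient_separable (C_hom i) (C_surj i) sepA.
have C1 i : (1 : C i) != 0.
  apply: contraNneq (e_neq0 (enum_val i)) => /(congr1 (@corner_val _ _)) /=.
  by rewrite mul1r mul0r => <-.
have Cinv i (x : C i) : x != 0 -> exists y, y * x = 1.
  move=> x_neq0; have [|y yE] := e_inv0 (enum_val i) (corner_val x).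
    rewrite (corner_mule x); apply: contraNneq x_neq0 => x0.
    by apply/eqP/val_inj; rewrite /= mul0r.
  exists (to_corner (E i) y); apply: val_inj; rewrite [LHS]corner_mulE /=.
  rewrite mul1r -mulrA [e i * _]mulrC (corner_mule x) -[RHS]yE.
  by rewrite mulrAC (corner_mule x) mulrC.
pose F i := KField (C1 i) (@Cinv i) (fdC i).
pose L i := kfield_ext (F i).
pose pr i : {rmorphism A -> L i} := to_corner (E i).
have pr_hom i x : pr i (kalg_str A x) = x%:A.
  by rewrite -[RHS]/(kalg_str (C i) x * 1) mulr1.
exists #|I|, L, pr; split=> // [i|y].
  apply: separable_algebra_fieldExt.
  exact: (@quotient_separable k A (field_kalg (L i)) (pr i) (pr_hom i) (C_surj i) sepA).
exists (\sum_i corner_val (y i)); split=> [i|a aE].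
  apply: val_inj; rewrite /= mulr_suml (bigD1 i) //= (corner_mule (y i)).
  rewrite big1 ?addr0 // => j ji.
  by rewrite -(corner_mule (y j)) -mulrA ee (negPf ji) mulr0.
rewrite -[a]mulr1 -e1 mulr_sumr; apply: eq_bigr => i _.
by rewrite -aE.
Qed.

(** * The ring of operators of an additive map *)

(** A commutative ring receiving two copies of [A]: the pair [(p, a)] acts on maps
    [F : A -> A] by [x |-> a * F (p * x)], and formal sums of pairs are identified
    when they act in the same way on [phi]. As the actions commute with each other,
    this relation is a congruence for the product. The two copies agree on the
    elements [c] with [phi (c * x) = c * phi x]; it is a stand-in for the tensor
    square of [A] over the subring of these elements. *)
Section OperatorRing.

Variables (A : comPzRingType) (phi : {additive A -> A}).
Implicit Types (s t : seq (A * A)) (F : A -> A).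

Definition operator_act s F (x : A) : A := \sum_(pa <- s) pa.2 * F (pa.1 * x).

Definition operator_mul s t : seq (A * A) :=
  [seq (pa.1 * qb.1, pa.2 * qb.2) | pa <- s, qb <- t].

Lemma operator_act_mul s t F :
  operator_act (operator_mul s t) F =1 operator_act s (operator_act t F).
Proof.
move=> x; rewrite /operator_act /operator_mul big_allpairs_dep /=.
apply: eq_bigr => pa _; rewrite mulr_sumr; apply: eq_bigr => qb _.
by rewrite mulrA [qb.1 * _]mulrCA !mulrA.
Qed.

Lemma operator_actC s t F :
  operator_act s (operator_act t F) =1 operator_act t (operator_act s F).
Proof.
move=> x; rewrite /operator_act; under eq_bigr do rewrite mulr_sumr.
rewrite exchange_big; apply: eq_bigr => qb _; rewrite mulr_sumr.
by apply: eq_bigr => pa _; rewrite mulrCA [qb.1 * _]mulrCA.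
Qed.

Lemma eq_operator_act s F G : F =1 G -> operator_act s F =1 operator_act s G.
Proof. by move=> FG x; apply: eq_bigr => pa _; rewrite FG. Qed.

Definition operator_eqb s t : bool :=
  `[< operator_act s phi =1 operator_act t phi >].

Lemma operator_eqb_refl : reflexive operator_eqb.
Proof. by move=> s; apply/asboolP. Qed.

Lemma operator_eqb_sym : symmetric operator_eqb.
Proof. by move=> s t; apply/asboolP/asboolP => st x; rewrite st. Qed.

Lemma operator_eqb_trans : transitive operator_eqb.
Proof. by move=> t s u /asboolP st /asboolP tu; apply/asboolP => x; rewrite st. Qed.

Canonical operator_equiv := EquivRel operator_eqb
  operator_eqb_refl operator_eqb_sym operator_eqb_trans.

Definition operator := {eq_quot operator_equiv}.

HB.instance Definition _ := Choice.on operator.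
HB.instance Definition _ := Quotient.on operator.
HB.instance Definition _ := EqQuotient.on operator.

Definition operator_of s : operator := \pi_operator s.

Definition operator_ev (r : operator) : A -> A := operator_act (repr r) phi.

Lemma operator_evE s : operator_ev (operator_of s) =1 operator_act s phi.
Proof.
suff /eqmodP/asboolP : repr (operator_of s) = s %[mod operator] by [].
exact: reprK.
Qed.

Lemma operator_ext (r r' : operator) : operator_ev r =1 operator_ev r' -> r = r'.
Proof.
move=> rr'; rewrite -[r]reprK -[r']reprK; apply/eqmodP/asboolP.
exact: rr'.
Qed.

Definition operator_add (r r' : operator) := operator_of (repr r ++ repr r').
Definition operator_opp (r : operator) :=
  operator_of [seq (pa.1, - pa.2) | pa <- repr r].
Definition operator_prod (r r' : operator) :=
  operator_of (operator_mul (repr r) (repr r')).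

Lemma operator_ev_add r r' x :
  operator_ev (operator_add r r') x = operator_ev r x + operator_ev r' x.
Proof. by rewrite operator_evE /operator_act big_cat. Qed.

Lemma operator_ev_opp r x : operator_ev (operator_opp r) x = - operator_ev r x.
Proof.
rewrite operator_evE /operator_act big_map -sumrN.
by apply: eq_bigr => pa _; rewrite mulNr.
Qed.

Lemma operator_ev_prod r r' x :
  operator_ev (operator_prod r r') x = operator_act (repr r) (operator_ev r') x.
Proof. by rewrite operator_evE operator_act_mul. Qed.

Lemma operator_prodC : commutative operator_prod.
Proof. by move=> r r'; apply: operator_ext => x; rewrite !operator_ev_prod operator_actC. Qed.

Lemma operator_addA : associative operator_add.
Proof. by move=> r s t; apply: operator_ext => x; rewrite !operator_ev_add addrA. Qed.
Lemma operator_addC : commutative operator_add.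
Proof. by move=> r s; apply: operator_ext => x; rewrite !operator_ev_add addrC. Qed.
Lemma operator_add0 : left_id (operator_of [::]) operator_add.
Proof.
move=> r; apply: operator_ext => x.
by rewrite operator_ev_add operator_evE /operator_act big_nil add0r.
Qed.
Lemma operator_addN : left_inverse (operator_of [::]) operator_opp operator_add.
Proof.
move=> r; apply: operator_ext => x; rewrite operator_ev_add operator_ev_opp addNr.
by rewrite operator_evE /operator_act big_nil.
Qed.

HB.instance Definition _ := GRing.isZmodule.Build operator
  operator_addA operator_addC operator_add0 operator_addN.

Lemma operator_prodA : associative operator_prod.
Proof.
move=> r s t; rewrite [RHS]operator_prodC; apply: operator_ext => x.
rewrite [LHS]operator_ev_prod [RHS]operator_ev_prod.
rewrite (eq_operator_act _ (operator_ev_prod s t)).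
rewrite (eq_operator_act _ (operator_ev_prod r s)) [RHS]operator_actC.
by apply: eq_operator_act => y; rewrite operator_actC.
Qed.
Lemma operator_prod1 : left_id (operator_of [:: (1, 1)]) operator_prod.
Proof.
move=> r; rewrite operator_prodC; apply: operator_ext => x.
rewrite operator_ev_prod -[RHS]/(operator_act _ _ _).
by apply: eq_operator_act => y; rewrite operator_evE /operator_act big_seq1 !mul1r.
Qed.
Lemma operator_prodDl : left_distributive operator_prod operator_add.
Proof.
move=> r s t; rewrite ![operator_prod _ t]operator_prodC; apply: operator_ext => x.
rewrite operator_ev_add !operator_ev_prod -big_split; apply: eq_bigr => pa _ /=.
by rewrite operator_ev_add mulrDr.
Qed.

HB.instance Definition _ := GRing.Zmodule_isComPzRing.Build operator
  operator_prodA operator_prodC operator_prod1 operator_prodDl.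

Definition operator_left (p : A) : operator := operator_of [:: (p, 1)].
Definition operator_right (a : A) : operator := operator_of [:: (1, a)].

Lemma operator_ev_left p x : operator_ev (operator_left p) x = phi (p * x).
Proof. by rewrite operator_evE /operator_act big_seq1 mul1r. Qed.
Lemma operator_ev_right a x : operator_ev (operator_right a) x = a * phi x.
Proof. by rewrite operator_evE /operator_act big_seq1 mul1r. Qed.

Lemma operator_ev_of_prod s r x :
  operator_ev (operator_of s * r) x = operator_act s (operator_ev r) x.
Proof.
rewrite mulrC [LHS]operator_ev_prod (eq_operator_act _ (operator_evE s)).
exact: operator_actC.
Qed.

Lemma operator_left_zmod : zmod_morphism operator_left.
Proof.
move=> p q; apply: operator_ext => x; rewrite [RHS]operator_ev_add operator_ev_opp.
by rewrite !operator_ev_left mulrBl raddfB.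
Qed.
Lemma operator_left_monoid : monoid_morphism operator_left.
Proof.
split=> // p q; apply: operator_ext => x; rewrite [RHS]operator_ev_of_prod.
by rewrite /operator_act big_seq1 mul1r !operator_ev_left mulrA [q * p]mulrC.
Qed.
HB.instance Definition _ :=
  GRing.isZmodMorphism.Build A operator operator_left operator_left_zmod.
HB.instance Definition _ :=
  GRing.isMonoidMorphism.Build A operator operator_left operator_left_monoid.

Lemma operator_right_zmod : zmod_morphism operator_right.
Proof.
move=> p q; apply: operator_ext => x; rewrite [RHS]operator_ev_add operator_ev_opp.
by rewrite !operator_ev_right mulrBl.
Qed.
Lemma operator_right_monoid : monoid_morphism operator_right.
Proof.
split=> // p q; apply: operator_ext => x; rewrite [RHS]operator_ev_of_prod.
by rewrite /operator_act big_seq1 mul1r !operator_ev_right mulrA.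
Qed.
HB.instance Definition _ :=
  GRing.isZmodMorphism.Build A operator operator_right operator_right_zmod.
HB.instance Definition _ :=
  GRing.isMonoidMorphism.Build A operator operator_right operator_right_monoid.

End OperatorRing.

(** * Cofree difference algebras and generators *)

Section Iteration.

Variables (R : pzRingType) (f : {rmorphism R -> R}) (n : nat).

Lemma iter_zmod : zmod_morphism (iter n f).
Proof. by move=> x y; elim: n => //= m ->; rewrite rmorphB. Qed.
Lemma iter_monoid : monoid_morphism (iter n f).
Proof.
split=> [|x y]; first by elim: n => //= m ->; rewrite rmorph1.
by elim: n => //= m ->; rewrite rmorphM.
Qed.

HB.instance Definition _ := GRing.isZmodMorphism.Build R R (iter n f) iter_zmod.
HB.instance Definition _ := GRing.isMonoidMorphism.Build R R (iter n f) iter_monoid.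

End Iteration.

Lemma iter_sigma_str (k : diffField) (A : diffAlg k) n x :
  iter n (sigma A) (kalg_str A x) = kalg_str A (iter n (sigma_field k) x).
Proof. by elim: n => //= n ->; rewrite sigma_str. Qed.

(** Sequences in [B] under the shift, the scalar [x] being the sequence of the
    [sigma^n x]. A difference morphism [f] from [A] to it is determined by the
    algebra morphism [a |-> f a 0], since [f a n = f (sigma^n a) 0]. *)
Section Cofree.

Variables (k : diffField) (B : kalg k).

Definition cofree_str (x : k) : nat -> B :=
  fun n => kalg_str B (iter n (sigma_field k) x).
Definition cofree_shift (b : nat -> B) : nat -> B := fun n => b n.+1.

Lemma cofree_str_zmod : zmod_morphism cofree_str.
Proof. by move=> x y; apply/funext => n; rewrite /cofree_str !rmorphB. Qed.
Lemma cofree_str_monoid : monoid_morphism cofree_str.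
Proof.
split=> [|x y]; apply/funext => n; first by rewrite /cofree_str !rmorph1.
by rewrite /cofree_str !rmorphM.
Qed.
HB.instance Definition _ :=
  GRing.isZmodMorphism.Build k (nat -> B) cofree_str cofree_str_zmod.
HB.instance Definition _ :=
  GRing.isMonoidMorphism.Build k (nat -> B) cofree_str cofree_str_monoid.

Lemma cofree_shift_zmod : zmod_morphism cofree_shift.
Proof. by []. Qed.
Lemma cofree_shift_monoid : monoid_morphism cofree_shift.
Proof. by []. Qed.
HB.instance Definition _ :=
  GRing.isZmodMorphism.Build (nat -> B) (nat -> B) cofree_shift cofree_shift_zmod.
HB.instance Definition _ :=
  GRing.isMonoidMorphism.Build (nat -> B) (nat -> B) cofree_shift cofree_shift_monoid.

Lemma cofree_shift_str x : cofree_shift (cofree_str x) = cofree_str (sigma_field k x).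
Proof. by apply/funext => n; rewrite /cofree_shift /cofree_str iterSr. Qed.

Definition cofree : diffAlg k :=
  @DiffAlg k (@KAlg k (nat -> B) cofree_str) cofree_shift cofree_shift_str.

End Cofree.

Section Generated.

Variables (k : fieldType) (A : kalg k) (X : A -> Prop).

Inductive generated : A -> Prop :=
  | generated_in a : X a -> generated a
  | generated_str x : generated (kalg_str A x)
  | generatedB a b : generated a -> generated b -> generated (a - b)
  | generatedM a b : generated a -> generated b -> generated (a * b).

Definition generated_pred : {pred A} := fun a => `[< generated a >].

Lemma generatedP a : reflect (generated a) (a \in generated_pred).
Proof. exact: asboolP. Qed.

Lemma generated_subring : subring_closed generated_pred.
Proof.
split=> [|a b /generatedP ga /generatedP gb|a b /generatedP ga /generatedP gb].
- by apply/generatedP; rewrite -(rmorph1 (kalg_str A)); apply: generated_str.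
- by apply/generatedP; apply: generatedB.
- by apply/generatedP; apply: generatedM.
Qed.

HB.instance Definition _ :=
  GRing.isSubringClosed.Build A generated_pred generated_subring.

Lemma eq_on_generated (B : comPzRingType) (g h : {rmorphism A -> B}) :
    (forall x, g (kalg_str A x) = h (kalg_str A x)) ->
    (forall a, X a -> g a = h a) ->
  forall a, generated a -> g a = h a.
Proof.
move=> gh_str ghX a; elim=> // [a' b _ ga _ gb|a' b _ ga _ gb].
  by rewrite !rmorphB ga gb.
by rewrite !rmorphM ga gb.
Qed.

End Generated.

Lemma generated_sub (k : fieldType) (A : kalg k) (X Y : A -> Prop) :
  (forall a, X a -> generated Y a) -> forall a, generated X a -> generated Y a.
Proof.
move=> XY a; elim=> [b /XY //|x|b c _ gb _ gc|b c _ gb _ gc].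
- exact: generated_str.
- exact: generatedB.
- exact: generatedM.
Qed.

Section GeneratedDiff.

Variables (k : diffField) (A : diffAlg k) (X : A -> Prop).
Hypothesis X_sigma : forall a, X a -> generated X (sigma A a).

Lemma generated_sigma a :
  a \in generated_pred X -> sigma A a \in generated_pred X.
Proof.
move=> /generatedP ga; apply/generatedP; elim: ga
  => [b /X_sigma //|x|b c _ gb _ gc|b c _ gb _ gc].
- by rewrite sigma_str; apply: generated_str.
- by rewrite rmorphB; apply: generatedB.
- by rewrite rmorphM; apply: generatedM.
Qed.

Lemma generated_str_mem x : kalg_str A x \in generated_pred X.
Proof. by apply/generatedP/generated_str. Qed.

Definition generated_diffSubalg : diffSubalg A :=
  @DiffSubalg k A (generated_pred X) generated_str_mem generated_sigma.

End GeneratedDiff.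

(** * Splicing points of a directly presented algebra *)

(** A morphism defined inside a proof, where instances cannot be declared. *)
Lemma rmorphism_of (R S : pzRingType) (f : R -> S) :
  zmod_morphism f -> monoid_morphism f -> {g : {rmorphism R -> S} | g =1 f}.
Proof.
move=> f_zmod f_monoid.
pose fz := GRing.isZmodMorphism.Build R S f f_zmod.
pose fm := GRing.isMonoidMorphism.Build R S f f_monoid.
by pose g : {rmorphism R -> S} := HB.pack f fz fm; exists g.
Qed.

Definition sigma_span (k : diffField) (A : diffAlg k) n (a : A) : Prop :=
  exists s : seq (k * A), a = \sum_(p <- s) kalg_str A p.1 * iter n (sigma A) p.2.

Arguments sigma_span {k} A n a.

Section Presented.

Variables (k : diffField) (X : cocorrespondence k) (A : diffAlg k).
Variable u : {rmorphism coc_C0 X -> A}.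
Hypothesis u_point : directed_point u.
Hypothesis u_universal : forall (B : diffAlg k) (c : {rmorphism coc_C0 X -> B}),
  directed_point c ->
  exists f : {rmorphism A -> B},
    [/\ is_diffAlg_hom f, f \o u =1 c &
        forall g : {rmorphism A -> B}, is_diffAlg_hom g -> g \o u =1 c -> g =1 f].

Definition orbit_before n (a : A) : Prop :=
  exists i z, (i < n)%N /\ a = iter i (sigma A) (u z).

Definition orbit_all (a : A) : Prop := exists n, orbit_before n a.

(** The subalgebra generated by the orbit of the universal element has the same
    universal property, so its inclusion is onto. *)
Lemma presented_generated a : generated orbit_all a.
Proof.
have orbit_sigma b : orbit_all b -> generated orbit_all (sigma A b).
  move=> [n [i [z [_ ->]]]]; apply: generated_in.
  by exists i.+2, i.+1, z.
pose S := generated_diffSubalg orbit_sigma.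
have uS z : u z \in diffSubalg_pred S.
  by apply/generatedP/generated_in; exists 1%N, 0%N, z.
have [||c cE] := @rmorphism_of (coc_C0 X) (subalg_diffAlg S)
  (fun z => DiffSubalgElt (uS z)).
- by move=> y z; apply: val_inj; rewrite /= rmorphB.
- by split=> [|y z]; apply: val_inj; rewrite /= ?rmorph1 ?rmorphM.
have val_c z : diffSubalg_val (c z) = u z by rewrite cE.
have c_point : directed_point c.
  split=> [x|z]; apply: val_inj => /=.
    by rewrite val_c u_point.1.
  by rewrite !val_c u_point.2.
have [f [[f_hom f_sigma] fu _]] := u_universal c_point.
have [||g gE] := @rmorphism_of A A (fun x => diffSubalg_val (f x)).
- by move=> x y; rewrite /= rmorphB.
- by split=> [|x y]; rewrite /= ?rmorph1 ?rmorphM.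
have [f0 [_ _ f0_uniq]] := u_universal u_point.
have gid : g a = a.
  rewrite (f0_uniq g); first by rewrite -(f0_uniq idfun).
    split=> [x|x]; rewrite !gE /=; first by rewrite f_hom.
    by rewrite f_sigma.
  by move=> z; rewrite /= gE /= -[f (u z)]/((f \o u) z) fu val_c.
by apply/generatedP; rewrite -gid gE /=; apply: diffSubalg_valP.
Qed.

(** The two points [g1], [g2] of [B] are infinite paths; if they meet at the
    vertex reached after [n] steps, the path that follows [g1] up to there and
    [g2] afterwards is again a point, because [B]-points of [A] are points in
    the cofree difference algebra on [B]. *)
Lemma splice (B : kalg k) (g1 g2 : {rmorphism A -> B}) n :
    is_kalg_hom g1 -> is_kalg_hom g2 ->
    (forall y, g1 (iter n (sigma A) (u (coc_p X y)))
             = g2 (iter n (sigma A) (u (coc_p X y)))) ->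
  exists h : {rmorphism A -> B},
    [/\ forall x, h (kalg_str A x) = kalg_str B x,
        forall a, generated (orbit_before n) a -> h a = g1 a &
        forall a, h (iter n (sigma A) a) = g2 (iter n (sigma A) a)].
Proof.
move=> g1_hom g2_hom meet.
pose path z : nat -> B := fun i =>
  if (i < n)%N then g1 (iter i (sigma A) (u z)) else g2 (iter i (sigma A) (u z)).
have [||c cE] := @rmorphism_of (coc_C0 X) (cofree B) path.
- move=> y z; apply/funext => i; rewrite -[RHS]/(path y i - path z i) /path.
  by case: ifP => _; rewrite !rmorphB.
- split=> [|y z]; apply/funext => i.
    by rewrite -[RHS]/(1 : B) /path; case: ifP => _; rewrite !rmorph1.
  rewrite -[RHS]/(path y i * path z i) /path.
  by case: ifP => _; rewrite !rmorphM.
have c_point : directed_point c.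
  split=> [x|z]; rewrite !cE; apply/funext => i; rewrite /path /=.
    rewrite u_point.1 iter_sigma_str g1_hom g2_hom if_same.
    by [].
  rewrite /cofree_shift -u_point.2.
  have iterE : iter i (sigma A) (sigma A (u (coc_p X z)))
             = iter i.+1 (sigma A) (u (coc_p X z)) by rewrite iterSr.
  by rewrite iterE; case: (ltngtP i.+1 n) => // in_eq; subst n.
have [f [[f_hom f_sigma] fu _]] := u_universal c_point.
have [||h hE] := @rmorphism_of A B (fun a => f a 0%N).
- by move=> x y; rewrite rmorphB.
- by split=> [|x y]; rewrite ?rmorph1 ?rmorphM.
have h_str x : h (kalg_str A x) = kalg_str B x by rewrite hE f_hom.
have f_iter i a : f a i = h (iter i (sigma A) a).
  rewrite hE; elim: i a => // i IH a.
  by rewrite iterSr -IH f_sigma.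
have h_orbit i z : h (iter i (sigma A) (u z)) = path z i.
  by rewrite -f_iter -[f (u z)]/((f \o u) z) fu cE.
exists h; split=> // a.
  apply: eq_on_generated => [x|_ [i [z [lt_in ->]]]]; first by rewrite h_str g1_hom.
  by rewrite h_orbit /path lt_in.
have := presented_generated a.
apply: (@eq_on_generated _ _ _ _ (h \o iter n (sigma A)) (g2 \o iter n (sigma A))).
  by move=> x; rewrite /= iter_sigma_str h_str g2_hom.
move=> _ [m [i [z [_ ->]]]] /=.
by rewrite -iterD h_orbit /path ltnNge leq_addr.
Qed.

(** Spliced at their common [n]-th vertex, the two copies of [A] in the operator
    ring of [phi = id - q] give a point at which [f] takes both the values
    [g1 f], as [f] is generated by the steps before that vertex, and [g2 f], as it
    is spanned by what comes after it. Evaluated at [1] this says [phi f = 0],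
    that is, [f = q f] is a function of the vertex. *)
Lemma head_tail n f :
    separable_algebra (coc_A0 X) ->
    generated (orbit_before n) f ->
    sigma_span A n f ->
  forall (I : finType) (v : I -> coc_A0 X), (forall y, spanned v y) ->
  spanned (fun i => iter n (sigma A) (u (coc_p X (v i)))) f.
Proof.
move=> sepA0 f_head [s f_tail] I v span_v.
pose tau : {rmorphism coc_A0 X -> A} := iter n (sigma A) \o (u \o coc_p X).
have tau_str x : tau (kalg_str _ x) = kalg_str A (iter n (sigma_field k) x).
  by rewrite /= coc_p_hom u_point.1 iter_sigma_str.
pose V := spanned (fun i => tau (v i)).
have V_tau y : V (tau y).
  have [c ->] := span_v y; exists (fun i => iter n (sigma_field k) (c i)).
  rewrite /comb rmorph_sum; apply: eq_bigr => i _.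
  by rewrite rmorphM tau_str.
have VM y b : V b -> V (tau y * b).
  move=> [c ->]; rewrite /comb mulr_sumr; apply: subspace_sum => [|i _].
    exact: spanned_subspace.
  rewrite mulrCA; apply: subspaceZ; first exact: spanned_subspace.
  by rewrite -rmorphM.
have [q [Vq qV q_lin q_tau]] :=
  equivariant_retraction tau_str sepA0 (spanned_subspace _) VM.
have qD x y : q (x + y) = q x + q y.
  by have := q_lin 1 x y; rewrite rmorph1 !mul1r.
pose phi0 x := x - q x.
have phi0_add : zmod_morphism phi0.
  move=> x y; rewrite /phi0; have -> : q (x - y) = q x - q y.
    by apply/eqP; rewrite eq_sym subr_eq -qD subrK.
  by rewrite !opprD addrACA.
pose phi : {additive A -> A} := HB.pack phi0
  (GRing.isZmodMorphism.Build A A phi0 phi0_add).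
pose B : kalg k := KAlg (operator_left phi \o kalg_str A).
have scalar_op x : operator_left phi (kalg_str A x) = operator_right phi (kalg_str A x).
  apply: operator_ext => y; rewrite operator_ev_left operator_ev_right /= /phi0.
  have := q_lin x y 0; have q0 : q 0 = 0 by apply: (addIr (q 0)); rewrite -qD !add0r.
  by rewrite q0 !addr0 => ->; rewrite mulrBr.
pose g1 : {rmorphism A -> B} := operator_left phi.
pose g2 : {rmorphism A -> B} := operator_right phi.
have g1_hom : is_kalg_hom g1 by [].
have g2_hom : is_kalg_hom g2 by move=> x; rewrite -[LHS]scalar_op.
have meet y : g1 (tau y) = g2 (tau y).
  apply: operator_ext => z; rewrite operator_ev_left operator_ev_right.
  by rewrite -![phi _]/(phi0 _) /phi0 q_tau mulrBr.
have [h [h_str h_head h_tail]] := splice g1_hom g2_hom meet.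
have f12 : g1 f = g2 f.
  rewrite -(h_head _ f_head) f_tail !rmorph_sum; apply: eq_bigr => i _.
  by rewrite !rmorphM h_str -g2_hom h_tail.
have := congr1 (fun r : operator phi => operator_ev r 1) f12.
rewrite operator_ev_left operator_ev_right mulr1 -![phi _]/(phi0 _) /phi0.
have -> : q 1 = 1 by apply: qV; rewrite -(rmorph1 tau); apply: V_tau.
by rewrite subrr mulr0 => /eqP; rewrite subr_eq0 => /eqP ->.
Qed.

End Presented.

(** * Strongly sigma-etale algebras *)

Section Bases.

Variables (k : fieldType) (A : kalg k) (I : finType) (v w : I -> A).
Hypotheses (free_v : free_family v) (span_v : forall a, spanned v a).

Lemma free_spanning : free_family w -> forall a, spanned w a.
Proof.
move=> free_w a; apply: contrapT => nwa.
have := free_card_le (fun j => span_v (extend_family w a j)) (free_extend free_w nwa).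
by rewrite card_sum card_unit addn1 ltnn.
Qed.

(** The matrices [M] and [N] of coordinates between [v] and [w] satisfy
    [N * M = 1], hence also [M * N = 1], being square. *)
Lemma spanning_free : (forall a, spanned w a) -> free_family w.
Proof.
move=> span_w c wc0.
have [M wE] := choice (fun i => span_v (w i)).
have [N vE] := choice (fun i => span_w (v i)).
have comp (f g : I -> A) (d : I -> k) (P : I -> I -> k) :
    (forall i, f i = comb g (P i)) ->
    comb f d = comb g (fun j => \sum_i d i * P i j).
  move=> fE; rewrite /comb; under eq_bigr do rewrite fE /comb mulr_sumr.
  rewrite exchange_big; apply: eq_bigr => j _ /=.
  rewrite rmorph_sum mulr_suml; apply: eq_bigr => i _.
  by rewrite rmorphM mulrA.
have cM j : \sum_i c i * M i j = 0.
  by move: j; apply: free_v; rewrite -(comp w).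
have NM i j : \sum_l N i l * M l j = (i == j)%:R.
  apply: (free_uniq free_v (c := fun j => \sum_l N i l * M l j)
    (d := fun j => (i == j)%:R)).
  rewrite -(comp w) // -vE -[LHS]comb_delta; congr (comb v _).
  by apply/funext => l; rewrite eq_sym.
pose mx (P : I -> I -> k) : 'M[k]_#|I| := \matrix_(i, j) P (enum_val i) (enum_val j).
have sumE (F : I -> k) : \sum_(i < #|I|) F (enum_val i) = \sum_i F i.
  by rewrite [RHS](reindex (@enum_val _ I)) //=; exists enum_rank => ? _;
    rewrite (enum_rankK, enum_valK).
have NM1 : mx N *m mx M = 1%:M.
  apply/matrixP => i j; rewrite !mxE -(inj_eq enum_val_inj) -NM -sumE.
  by apply: eq_bigr => l _; rewrite !mxE.
have /mulmx1C MN1 := NM1.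
pose r : 'rV_#|I| := \row_i c (enum_val i).
have rM : r *m mx M = 0.
  apply/rowP => j; rewrite !mxE -[RHS](cM (enum_val j)) -sumE.
  by apply: eq_bigr => l _; rewrite !mxE.
move=> i; have : r 0 (enum_rank i) = 0.
  by rewrite -[r]mulmx1 -MN1 mulmxA rM mul0mx mxE.
by rewrite mxE enum_rankK.
Qed.

End Bases.

Section SigmaSpan.

Variables (k : diffField) (A : diffAlg k).

Lemma sigma_span_subspace n : subspace (sigma_span A n).
Proof.
split=> [|x _ _ [s ->] [t ->]]; first by exists [::]; rewrite big_nil.
exists ([seq (x * p.1, p.2) | p <- s] ++ t); rewrite big_cat big_map /=.
rewrite mulr_sumr; congr (_ + _); apply: eq_bigr => p _.
by rewrite rmorphM mulrA.
Qed.

Lemma sigma_span_iter n a : sigma_span A n (iter n (sigma A) a).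
Proof. by exists [:: (1, a)]; rewrite big_seq1 rmorph1 mul1r. Qed.

Lemma sigma_spanM n a b :
  sigma_span A n a -> sigma_span A n b -> sigma_span A n (a * b).
Proof.
move=> [s ->] [t ->]; have hU := sigma_span_subspace n.
rewrite mulr_suml; apply: subspace_sum => // p _.
rewrite mulr_sumr; apply: subspace_sum => // q _.
rewrite mulrACA -rmorphM; apply: subspaceZ => //.
by have := sigma_span_iter n (p.2 * q.2); rewrite rmorphM.
Qed.

Lemma sigma_span_all n :
  (forall a : A, sigma_span A 1 a) -> forall a : A, sigma_span A n a.
Proof.
move=> span1; elim: n => [|n IH] a; first exact: (sigma_span_iter 0).
have [s ->] := span1 a; have hU := sigma_span_subspace n.+1.
apply: subspace_sum => // p _; apply: subspaceZ => //=.
have [t ->] := IH p.2; rewrite rmorph_sum; apply: subspace_sum => // q _.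
rewrite rmorphM sigma_str; apply: subspaceZ => //.
exact: (sigma_span_iter n.+1).
Qed.

End SigmaSpan.

(** A linear form [h] on [A] has a base change [a (x) l |-> sigma (h a) * l];
    coordinate forms show that a basis of [A] stays free in the base change. *)
Lemma tensor_eq_invariant (k : diffField) (A : kalg k) (h : A -> k) :
    (forall a b, h (a + b) = h a + h b) ->
    (forall x a, h (kalg_str A x * a) = x * h a) ->
  forall s t : seq (A * k), tensor_eq s t ->
    \sum_(p <- s) sigma_field k (h p.1) * p.2
    = \sum_(p <- t) sigma_field k (h p.1) * p.2.
Proof.
move=> hD hZ s t; elim=> //=.
- by move=> {}t {}s u _ -> _ ->.
- by move=> {}s s' {}t t' _ + _; rewrite !big_cat /= => -> ->.
- by move=> {}s {}t; rewrite !big_cat /= addrC.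
- move=> l; rewrite big_seq1 big_nil /=.
  have -> : h 0 = 0 by apply: (addIr (h 0)); rewrite -hD !add0r.
  by rewrite rmorph0 mul0r.
- by move=> a b l; rewrite !big_cons !big_nil /= !addr0 hD rmorphD mulrDl.
- by move=> a l m; rewrite !big_cons !big_nil /= !addr0 mulrDr.
- by move=> x a l; rewrite !big_seq1 /= hZ rmorphM mulrCA mulrA.
Qed.

Section BaseChangeTensor.

Variables (k : diffField) (A : kalg k).

Lemma tensorDl (a b : A) l : tensor (a + b) l = tensor a l + tensor b l.
Proof.
rewrite -[RHS]/(tensor_add _ _) tensor_addE.
exact/tensor_sumP/tensor_Dl.
Qed.

Lemma tensorDr (a : A) l m : tensor a (l + m) = tensor a l + tensor a m.
Proof.
rewrite -[RHS]/(tensor_add _ _) tensor_addE.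
exact/tensor_sumP/tensor_Dr.
Qed.

Lemma tensor0r (a : A) : tensor a 0 = 0.
Proof. by apply: (addIr (tensor a 0)); rewrite -tensorDr !add0r. Qed.

Lemma tensor0l l : tensor (0 : A) l = 0.
Proof. by apply: (addIr (tensor 0 l)); rewrite -tensorDl !add0r. Qed.

Lemma tensorZ x (a : A) l :
  tensor (kalg_str A x * a) l = tensor a (sigma_field k x * l).
Proof. exact/tensor_sumP/tensor_balanced. Qed.

Lemma tensor_basis (I : finType) (v : I -> A) (y : base_change A) :
  (forall a, spanned v a) -> exists c, y = \sum_i tensor (v i) (c i).
Proof.
move=> span_v; rewrite -(tensor_sumK y) tensor_sumE.
elim: (repr y) => [|[a l] s [c IH]].
  by exists (fun=> 0); rewrite big_nil big1 // => i _; rewrite tensor0r.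
have [d aE] := span_v a.
exists (fun i => sigma_field k (d i) * l + c i); rewrite big_cons IH /=.
rewrite {1}aE /comb (big_morph (fun a => tensor a l)
  (fun a b => tensorDl a b l) (tensor0l l)) -big_split.
by apply: eq_bigr => i _; rewrite tensorDr tensorZ.
Qed.

End BaseChangeTensor.

(** In finite dimension the source and target of [sigma_mul] have the same
    dimension, so it is injective exactly when it is onto. *)
Lemma sigma_separableP (k : diffField) (A : diffAlg k) : finite_dimensional A ->
  sigma_separable A <-> forall a : A, sigma_span A 1 a.
Proof.
move=> /finite_dimensional_basis[I [v [free_v span_v]]].
pose w i := sigma A (v i).
have [c cE] := choice span_v.
have mulE d : sigma_mul (\sum_i tensor (v i) (d i)) = comb w d.
  rewrite (big_morph _ (@sigma_mulD k A) (_ : _ = 0)); last first.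
    by apply: (addIr (sigma_mul 0)); rewrite -sigma_mulD !add0r.
  by apply: eq_bigr => i _; rewrite sigma_mul_tensor mulrC.
split=> [sepA a1|span1].
  have free_w : free_family w.
    move=> d; rewrite -mulE => d0 j.
    have /sepA : sigma_mul (\sum_i tensor (v i) (d i)) = sigma_mul 0.
      rewrite d0; apply: (addIr (sigma_mul (0 : base_change A))).
      by rewrite -sigma_mulD !add0r.
    have -> : \sum_i tensor (v i) (d i)
        = tensor_sum [seq (v i, d i) | i <- index_enum I].
      by rewrite tensor_sumE big_map.
    move/tensor_sumP; pose h (a : A) := c a j.
    have cP x a b : h (kalg_str A x * a + b) = x * h a + h b.
      apply: (free_uniq free_v (d := fun j => x * c a j + c b j)).
      by rewrite -cE combP -!cE.
    have hD a b : h (a + b) = h a + h b.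
      by have := cP 1 a b; rewrite rmorph1 !mul1r.
    have h0 : h 0 = 0 by apply: (addIr (h 0)); rewrite -hD !add0r.
    have hZ x a : h (kalg_str A x * a) = x * h a.
      by have := cP x a 0; rewrite h0 !addr0.
    move/(tensor_eq_invariant hD hZ); rewrite big_nil big_map /= => <-.
    have hv i : h (v i) = (i == j)%:R.
      have := free_uniq free_v (d := fun l => (l == i)%:R) (esym (etrans _ (cE (v i)))).
      rewrite comb_delta => /(_ erefl j); rewrite /h => ->.
      by rewrite eq_sym.
    rewrite (bigD1 j) //= hv eqxx rmorph1 mul1r big1 ?addr0 // => i /negPf ij.
    by rewrite hv ij rmorph0 mul0r.
  have [d ->] := free_spanning span_v free_w a1.
  by exists [seq (d i, v i) | i <- index_enum I]; rewrite big_map.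
have span_w a : spanned w a.
  have [s ->] := span1 a; apply: subspace_sum => [|p _]; first exact: spanned_subspace.
  apply: subspaceZ; first exact: spanned_subspace.
  rewrite /= [p.2]cE /comb rmorph_sum; apply: subspace_sum => [|i _].
    exact: spanned_subspace.
  rewrite rmorphM sigma_str; apply: subspaceZ; first exact: spanned_subspace.
  exact: spanned_gen.
have free_w := spanning_free free_v span_v span_w.
move=> x y /eqP; have [d ->] := tensor_basis x span_v.
have [d' ->] := tensor_basis y span_v; rewrite !mulE => /eqP eq_dd'.
by apply: eq_bigr => i _; rewrite (free_uniq free_w eq_dd').
Qed.

Lemma strongly_sigma_etaleP (k : diffField) (A : diffAlg k) :
  strongly_sigma_etale A <->
  [/\ finite_dimensional A, separable_algebra A & forall a : A, sigma_span A 1 a].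
Proof.
split=> [[sepA /etaleP[fdA sA]]|[fdA sA span1]].
  by split=> //; apply/sigma_separableP.
by split; [apply/sigma_separableP | apply/etaleP].
Qed.

(** * Composita and the strong core *)

Section Compositum.

Variables (k : diffField) (B1 B2 B : diffAlg k).
Variables (j1 : {rmorphism B1 -> B}) (j2 : {rmorphism B2 -> B}).
Hypotheses (j1_hom : is_diffAlg_hom j1) (j2_hom : is_diffAlg_hom j2).
Hypothesis B_generated :
  forall b : B, generated (fun b => (exists x, b = j1 x) \/ exists y, b = j2 y) b.

Lemma spanned_mul (I J : finType) (v : I -> B) (w : J -> B) (U : B -> Prop) :
    subspace U -> (forall i j, U (v i * w j)) ->
  forall a b, spanned v a -> spanned w b -> U (a * b).
Proof.
move=> hU Uvw _ _ [c ->] [d ->]; rewrite /comb mulr_suml.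
apply: subspace_sum => // i _; rewrite mulr_sumr; apply: subspace_sum => // j _.
by rewrite mulrACA -rmorphM; apply: subspaceZ.
Qed.

Lemma compositum_finite_dimensional :
  finite_dimensional B1 -> finite_dimensional B2 -> finite_dimensional B.
Proof.
move=> [I1 [v1 span1]] [I2 [v2 span2]].
pose v (i : I1 * I2) := j1 (v1 i.1) * j2 (v2 i.2).
exists (I1 * I2)%type, v.
have hU := spanned_subspace v.
have s1 x : spanned (j1 \o v1) (j1 x).
  by have [c ->] := span1 x; rewrite (hom_comb j1_hom.1); exists c.
have s2 y : spanned (j2 \o v2) (j2 y).
  by have [c ->] := span2 y; rewrite (hom_comb j2_hom.1); exists c.
have prod x y : spanned v (j1 x * j2 y).
  apply: spanned_mul (s1 x) (s2 y) => // i j; exact: (spanned_gen v (i, j)).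
move=> b; elim: (B_generated b)
  => [_ [[x ->]|[y ->]]|x|a a' _ ga _ ga'|a a' _ ga _ ga'].
- by have := prod x 1; rewrite rmorph1 mulr1.
- by have := prod 1 y; rewrite rmorph1 mul1r.
- have := prod (kalg_str B1 x) 1; rewrite rmorph1 mulr1.
  by rewrite (j1_hom.1 x).
- by apply: subspaceD => //; apply: subspaceN.
- by apply: spanned_mul ga ga' => // i i'; rewrite /v mulrACA -!rmorphM.
Qed.

(** The product of the images of the two separability idempotents; the elements
    under which it is invariant form a subalgebra containing both images. *)
Lemma compositum_separable :
  separable_algebra B1 -> separable_algebra B2 -> separable_algebra B.
Proof.
move=> [I1 [a1 [b1 [ab1 inv1]]]] [I2 [a2 [b2 [ab2 inv2]]]].
pose a (i : I1 * I2) := j1 (a1 i.1) * j2 (a2 i.2).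
pose b (i : I1 * I2) := j1 (b1 i.1) * j2 (b2 i.2).
exists (I1 * I2)%type, a, b; split.
  rewrite -(pair_bigA _ (fun i j => a (i, j) * b (i, j))) /= /a /b /=.
  have -> : 1 = j1 (\sum_i a1 i * b1 i) * j2 (\sum_i a2 i * b2 i).
    by rewrite ab1 ab2 !rmorph1 mulr1.
  rewrite !rmorph_sum mulr_suml; apply: eq_bigr => i _.
  rewrite mulr_sumr; apply: eq_bigr => j _.
  by rewrite !rmorphM mulrACA.
move=> c; elim: (B_generated c)
  => [_ [[x ->]|[y ->]]|x|c1 c2 _ h1 _ h2|c1 c2 _ h1 _ h2].
- move=> W f hf.
  rewrite -(pair_bigA _ (fun i j => f (j1 x * a (i, j)) (b (i, j)))) /=.
  rewrite -(pair_bigA _ (fun i j => f (a (i, j)) (j1 x * b (i, j)))) /=.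
  rewrite exchange_big [RHS]exchange_big; apply: eq_bigr => j _ /=.
  have bal : balanced (fun y z : B1 => f (j1 y * j2 (a2 j)) (j1 z * j2 (b2 j))).
    split=> [z y y'|y z z'|l y z].
    - by rewrite rmorphD mulrDl (balancedDl hf).
    - by rewrite rmorphD mulrDl (balancedDr hf).
    - by rewrite !rmorphM j1_hom.1 -!mulrA; case: hf => _ _ ->.
  have := inv1 x _ _ bal; rewrite /a /b /=.
  under eq_bigr do rewrite rmorphM -mulrA.
  by under [X in _ = X -> _]eq_bigr do rewrite rmorphM -mulrA.
- move=> W f hf.
  rewrite -(pair_bigA _ (fun i j => f (j2 y * a (i, j)) (b (i, j)))) /=.
  rewrite -(pair_bigA _ (fun i j => f (a (i, j)) (j2 y * b (i, j)))) /=.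
  apply: eq_bigr => i _ /=.
  have bal : balanced (fun x z : B2 => f (j1 (a1 i) * j2 x) (j1 (b1 i) * j2 z)).
    split=> [z x x'|x z z'|l x z].
    - by rewrite rmorphD mulrDr (balancedDl hf).
    - by rewrite rmorphD mulrDr (balancedDr hf).
    - by rewrite !rmorphM j2_hom.1 ![j1 _ * (_ * _)]mulrCA; case: hf => _ _ ->.
  have := inv2 y _ _ bal; rewrite /a /b /=.
  under eq_bigr do rewrite rmorphM mulrCA.
  by under [X in _ = X -> _]eq_bigr do rewrite rmorphM mulrCA.
- exact: tensor_invariant_str.
- exact: tensor_invariantB.
- exact: tensor_invariantM.
Qed.

(** The span of the image of [sigma] is a subalgebra, so it is enough that it
    contains generators. *)
Lemma compositum_sigma_span :
    (forall x : B1, sigma_span B1 1 x) -> (forall y : B2, sigma_span B2 1 y) ->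
  forall b : B, sigma_span B 1 b.
Proof.
have hU := @sigma_span_subspace k B 1.
have image (C : diffAlg k) (j : {rmorphism C -> B}) :
    is_diffAlg_hom j -> forall x, sigma_span C 1 x -> sigma_span B 1 (j x).
  move=> [j_str j_sigma] _ [s ->]; exists [seq (p.1, j p.2) | p <- s].
  rewrite big_map rmorph_sum; apply: eq_bigr => p _.
  by rewrite rmorphM j_str /= j_sigma.
move=> span1 span2 b.
elim: (B_generated b) => [_ [[x ->]|[y ->]]|x|a a' _ ga _ ga'|a a' _ ga _ ga'].
- exact: image.
- exact: image.
- rewrite -[kalg_str B x]mulr1; apply: subspaceZ => //.
  by have := @sigma_span_iter k B 1 1; rewrite rmorph1.
- by apply: subspaceD => //; apply: subspaceN.
- exact: sigma_spanM.
Qed.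

Lemma compositum_strongly_sigma_etale :
  strongly_sigma_etale B1 -> strongly_sigma_etale B2 -> strongly_sigma_etale B.
Proof.
move=> /strongly_sigma_etaleP[fd1 sep1 span1] /strongly_sigma_etaleP[fd2 sep2 span2].
apply/strongly_sigma_etaleP; split.
- exact: compositum_finite_dimensional.
- exact: compositum_separable.
- exact: compositum_sigma_span.
Qed.

End Compositum.

Section Subalgebras.

Variables (k : diffField) (A : diffAlg k).
Implicit Types S T : diffSubalg A.

Lemma diffSubalg_subspace S : subspace (fun a => a \in diffSubalg_pred S).
Proof.
by split=> [|x a b Sa Sb]; rewrite ?rpred0 ?rpredD ?rpredM ?diffSubalg_str.
Qed.

Lemma diffSubalg_inclusion S T :
    (forall a, a \in diffSubalg_pred S -> a \in diffSubalg_pred T) ->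
  exists j : {rmorphism subalg_diffAlg S -> subalg_diffAlg T},
    is_diffAlg_hom j /\ forall x, diffSubalg_val (j x) = diffSubalg_val x.
Proof.
move=> ST; pose j0 (x : subalg_diffAlg S) : subalg_diffAlg T :=
  DiffSubalgElt (ST _ (diffSubalg_valP x)).
have [||j jE] := @rmorphism_of (subalg_diffAlg S) (subalg_diffAlg T) j0.
- by move=> x y; apply: val_inj.
- by split=> [|x y]; apply: val_inj.
exists j; split=> [|x]; last by rewrite jE.
by split=> x; apply: val_inj; rewrite /= !jE.
Qed.

Lemma generated_subalg (X : A -> Prop) (hX : forall a, X a -> generated X (sigma A a))
    (b : subalg_diffAlg (generated_diffSubalg hX)) :
  generated
    (fun c : subalg_diffAlg (generated_diffSubalg hX) => X (diffSubalg_val c)) b.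
Proof.
have : generated X (diffSubalg_val b) by apply/generatedP; apply: diffSubalg_valP.
move: {2}(diffSubalg_val b) (erefl (diffSubalg_val b)) => a bE ga.
rewrite bE in ga; elim: ga b bE => [c Xc|x|c d gc IHc gd IHd|c d gc IHc gd IHd] b bE.
- by apply: generated_in; rewrite bE.
- have -> : b = kalg_str (subalg_diffAlg (generated_diffSubalg hX)) x by apply: val_inj.
  exact: generated_str.
- have memc : c \in diffSubalg_pred (generated_diffSubalg hX) by apply/generatedP.
  have memd : d \in diffSubalg_pred (generated_diffSubalg hX) by apply/generatedP.
  have -> : b = (DiffSubalgElt memc : subalg_diffAlg _) - DiffSubalgElt memd.
    exact: val_inj.
  by apply: generatedB; [apply: IHc | apply: IHd].
- have memc : c \in diffSubalg_pred (generated_diffSubalg hX) by apply/generatedP.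
  have memd : d \in diffSubalg_pred (generated_diffSubalg hX) by apply/generatedP.
  have -> : b = (DiffSubalgElt memc : subalg_diffAlg _) * DiffSubalgElt memd.
    exact: val_inj.
  by apply: generatedM; [apply: IHc | apply: IHd].
Qed.

Lemma strongly_sigma_etale_join S1 S2 :
    strongly_sigma_etale (subalg_diffAlg S1) ->
    strongly_sigma_etale (subalg_diffAlg S2) ->
  exists T : diffSubalg A, [/\ strongly_sigma_etale (subalg_diffAlg T),
    forall a, a \in diffSubalg_pred S1 -> a \in diffSubalg_pred T &
    forall a, a \in diffSubalg_pred S2 -> a \in diffSubalg_pred T].
Proof.
move=> et1 et2.
pose X (a : A) := a \in diffSubalg_pred S1 \/ a \in diffSubalg_pred S2.
have hX a : X a -> generated X (sigma A a).
  by move=> [aS|aS]; apply: generated_in; [left | right]; apply: diffSubalg_sigma.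
pose T := generated_diffSubalg hX.
have S1T a : a \in diffSubalg_pred S1 -> a \in diffSubalg_pred T.
  by move=> aS; apply/generatedP/generated_in; left.
have S2T a : a \in diffSubalg_pred S2 -> a \in diffSubalg_pred T.
  by move=> aS; apply/generatedP/generated_in; right.
exists T; split=> //.
have [j1 [j1_hom j1E]] := diffSubalg_inclusion S1T.
have [j2 [j2_hom j2E]] := diffSubalg_inclusion S2T.
apply: (compositum_strongly_sigma_etale j1_hom j2_hom) et1 et2 => b.
apply: generated_sub (generated_subalg b) => c [cS|cS]; apply: generated_in.
  by left; exists (DiffSubalgElt cS); apply: val_inj; rewrite /= j1E.
by right; exists (DiffSubalgElt cS); apply: val_inj; rewrite /= j2E.
Qed.

(** The image of the base field in [A], which is the zero ring when [A] is. *)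
Lemma strongly_sigma_etale_base :
  exists S : diffSubalg A, strongly_sigma_etale (subalg_diffAlg S).
Proof.
have hX (a : A) : False -> generated (fun=> False) (sigma A a) by [].
exists (generated_diffSubalg hX); set B := subalg_diffAlg _.
have B_str (b : B) : exists x, b = kalg_str B x.
  elim: (generated_subalg b) => [//|x|c d _ [x ->] _ [y ->]|c d _ [x ->] _ [y ->]].
  - by exists x.
  - by exists (x - y); rewrite rmorphB.
  - by exists (x * y); rewrite rmorphM.
apply/strongly_sigma_etaleP; split.
- exists unit, (fun=> 1) => b; have [x ->] := B_str b; exists (fun=> x).
  by rewrite /comb (big_pred1 tt) ?mulr1 // => [[]].
- exists unit, (fun=> 1), (fun=> 1); split=> [|b].
    by rewrite (big_pred1 tt) ?mulr1 // => [[]].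
  by have [x ->] := B_str b; apply: tensor_invariant_str.
- move=> b; have [x ->] := B_str b; exists [:: (x, 1)].
  by rewrite big_seq1 /= rmorph1 mulr1.
Qed.

End Subalgebras.

(** A finite-dimensional subalgebra involves only the first [m] steps of a path;
    if it is also spanned by its image under [sigma^m], all its elements are
    functions of the [m]-th vertex, a space spanned by the images of the [v i]. *)
Lemma strongly_sigma_etale_bound (k : diffField) (X : cocorrespondence k)
    (A : diffAlg k) (I : finType) (v : I -> coc_A0 X) :
    separable_algebra (coc_A0 X) -> (forall y, spanned v y) ->
    directly_presented X A ->
  forall (S : diffSubalg A) (J : finType) (w : J -> A),
    strongly_sigma_etale (subalg_diffAlg S) ->
    (forall j, w j \in diffSubalg_pred S) -> free_family w -> (#|J| <= #|I|)%N.
Proof.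
move=> sepA0 span_v [u [u_point u_univ]] S J w.
move=> /strongly_sigma_etaleP[fdS _ spanS] wS free_w.
have before_le n m a : (n <= m)%N ->
    generated (orbit_before u n) a -> generated (orbit_before u m) a.
  move=> le_nm; apply: generated_sub => _ [i [z [lt_in ->]]]; apply: generated_in.
  by exists i, z; split=> //; apply: leq_trans le_nm.
have before_ex a : exists n, generated (orbit_before u n) a.
  elim: (presented_generated u_point u_univ a)
    => [b [n bn]|x|b c _ [n bn] _ [m cm]|b c _ [n bn] _ [m cm]].
  - by exists n; apply: generated_in.
  - by exists 0%N; apply: generated_str.
  - exists (maxn n m); apply: generatedB; [apply: before_le bn | apply: before_le cm].
      exact: leq_maxl.
    exact: leq_maxr.
  - exists (maxn n m); apply: generatedM; [apply: before_le bn | apply: before_le cm].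
      exact: leq_maxl.
    exact: leq_maxr.
have [L [e span_e]] := fdS.
have [n nE] := choice (fun l => before_ex (diffSubalg_val (e l))).
pose m := \max_l n l.
have val_str x : diffSubalg_val (kalg_str (subalg_diffAlg S) x) = kalg_str A x by [].
have gen_subspace : subspace (generated (orbit_before u m)).
  split=> [|x a b ga gb].
    by rewrite -(rmorph0 (kalg_str A)); apply: generated_str.
  rewrite -[b]opprK -[- b]sub0r; apply: generatedB.
    by apply: generatedM => //; apply: generated_str.
  apply: generatedB => //.
  by rewrite -(rmorph0 (kalg_str A)); apply: generated_str.
pose val_S (a : subalg_diffAlg S) : A := diffSubalg_val a.
have val_sum (T : Type) (r : seq T) (F : T -> subalg_diffAlg S) :
    val_S (\sum_(t <- r) F t) = \sum_(t <- r) val_S (F t).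
  by apply: (big_morph val_S).
have head (a : subalg_diffAlg S) : generated (orbit_before u m) (val_S a).
  have [c ->] := span_e a; rewrite val_sum; apply: subspace_sum => // l _.
  apply: (subspaceZ (a := val_S (e l)) _ gen_subspace).
  by apply: before_le (nE l); apply: (bigmax_sup l).
have val_iter i (a : subalg_diffAlg S) :
    val_S (iter i (sigma (subalg_diffAlg S)) a) = iter i (sigma A) (val_S a).
  by elim: i => //= i <-.
have tail (a : subalg_diffAlg S) : sigma_span A m (val_S a).
  have [s ->] := sigma_span_all m spanS a.
  exists [seq (p.1, val_S p.2) | p <- s]; rewrite big_map val_sum.
  by apply: eq_bigr => p _ /=; rewrite -val_iter.
apply: free_card_le free_w => j.
have -> : w j = val_S (DiffSubalgElt (wS j)) by [].
exact: (head_tail u_point u_univ sepA0 (head _) (tail _) span_v).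
Qed.

Theorem proposition5p14 (k : diffField) (A : diffAlg k)
    (hA : finitely_sigma_presented_etale A) :
  exists S : diffSubalg A,
    (forall a : A, a \in diffSubalg_pred S <-> strong_core a) /\
    strongly_sigma_etale (subalg_diffAlg S).
Proof.
have [X [/etaleP[[I [v span_v]] sepA0] _ presA]] := hA.
pose P m := `[< exists (S : diffSubalg A) (J : finType) (w : J -> A),
  [/\ strongly_sigma_etale (subalg_diffAlg S), #|J| = m,
      forall j, w j \in diffSubalg_pred S & free_family w] >].
have exP : exists m, P m.
  have [S etS] := strongly_sigma_etale_base A.
  exists 0%N; apply/asboolP; exists S, void, (fun i : void => 0).
  by split=> [|||c _ []]; rewrite ?card_void //; case.
have leP m : P m -> (m <= #|I|)%N.
  move=> /asboolP[S [J [w [etS <- wS free_w]]]].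
  exact: (strongly_sigma_etale_bound sepA0 span_v presA etS wS free_w).
case: (ex_maxnP exP leP) => m /asboolP[S [J [w [etS cardJ wS free_w]]]] max_m.
exists S; split=> // a; split=> [aS|[S' [etS' aS']]]; first by exists S.
have [T [etT ST S'T]] := strongly_sigma_etale_join etS etS'.
apply: (spanned_sub (diffSubalg_subspace S) wS).
apply: contrapT => nwa; suff /max_m : P m.+1 by rewrite ltnn.
apply/asboolP; exists T, (J + unit)%type, (extend_family w a); split=> //.
- by rewrite card_sum card_unit cardJ addn1.
- by case=> [j|_] /=; [apply: ST | apply: S'T].
- exact: free_extend.
Qed.
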